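(* Let $v,a,b,c\in\mathbb{C}$ with $\Re(v)<1$, $\Re(c)>0$, and $\Re(vc+a+b)>0$, $\Re(vc+a-b)>0$, $\Re(vc-a+b)>0$, $\Re(vc-a-b)>0$. Fix a square root $\sqrt{a^2+b^2}$ and put $\lambda_1=\frac v2-\frac{\sqrt{a^2+b^2}}{2c}$, $\lambda_2=\frac v2+\frac{\sqrt{a^2+b^2}}{2c}$, $\sigma_3=\frac v2-\frac{a}{2c}-\frac{b}{2c}$, $\sigma_4=\frac v2-\frac{a}{2c}+\frac{b}{2c}$, $\sigma_5=\frac v2+\frac{a}{2c}+\frac{b}{2c}$, $\sigma_6=\frac v2+\frac{a}{2c}-\frac{b}{2c}$, and $P=(vc-a-b)(vc+a+b)(vc-a+b)(vc+a-b)$. Assume $\frac v2,\lambda_1,\lambda_2\notin\mathbb{Z}_0^-$ and $1+\sigma_j\notin\mathbb{Z}_0^-$ for $j=3,4,5,6$. Then $$ {}_8F_7\!\left(\begin{matrix}v,\ 1+\frac v2,\ 1+\lambda_1,\ 1+\lambda_2,\ \sigma_3,\ \sigma_4,\ \sigma_5,\ \sigma_6\\ \frac v2,\ \lambda_1,\ \lambda_2,\ 1+\sigma_3,\ 1+\sigma_4,\ 1+\sigma_5,\ 1+\sigma_6\end{matrix};\,1\right) =\frac{P}{8\,(v^3c^4-a^2vc^2-b^2vc^2)\,\Gamma(v)}\left[\Gamma(\sigma_5)\Gamma(\sigma_3)\frac{\cos\!\big(\frac{(a+b)\pi}{2c}\big)}{\cos(\frac{v\pi}{2})}+\Gamma(\sigma_6)\Gamma(\sigma_4)\frac{\cos\!\big(\frac{(a-b)\pi}{2c}\big)}{\cos(\frac{v\pi}{2})}\right].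 $$
   Context: $\mathbb{Z}_0^-=\{0,-1,-2,\dots\}$. The Pochhammer symbol is $(\lambda)_0=1$, $(\lambda)_n=\lambda(\lambda+1)\cdots(\lambda+n-1)$ for $n\ge1$. The generalized hypergeometric series is ${}_pF_q\!\left(\begin{matrix}\alpha_1,\dots,\alpha_p\\ \beta_1,\dots,\beta_q\end{matrix};z\right)=\sum_{n=0}^\infty\frac{(\alpha_1)_n\cdots(\alpha_p)_n}{(\beta_1)_n\cdots(\beta_q)_n}\frac{z^n}{n!}$ (with no $\beta_j\in\mathbb{Z}_0^-$); when $p=q+1$ and $z=1$ it converges if $\Re(\sum\beta_j-\sum\alpha_i)>0$. $\Gamma$ is Euler's gamma function. *)

(* Defs.v *)
From Stdlib Require Import Reals Lra List ClassicalEpsilon Arith Factorial.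
Open Scope R_scope.

Record Cx : Type := mkC { Re : R ; Im : R }.

Definition RtoC (x : R) : Cx := mkC x 0.
Definition Cx0 : Cx := RtoC 0.
Definition Cx1 : Cx := RtoC 1.
Definition Ci : Cx := mkC 0 1.
Definition Cadd (z w : Cx) : Cx := mkC (Re z + Re w) (Im z + Im w).
Definition Copp (z : Cx) : Cx := mkC (- Re z) (- Im z).
Definition Csub (z w : Cx) : Cx := Cadd z (Copp w).
Definition Cmul (z w : Cx) : Cx :=
  mkC (Re z * Re w - Im z * Im w) (Re z * Im w + Im z * Re w).
(* total inverse; Cinv Cx0 = Cx0 (never used at 0 in the statement's
   well-defined expressions) *)
Definition Cinv (z : Cx) : Cx :=
  let d := Re z * Re z + Im z * Im z in mkC (Re z / d) (- Im z / d).
Definition Cdiv (z w : Cx) : Cx := Cmul z (Cinv w).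
Definition Cnorm (z : Cx) : R := sqrt (Re z * Re z + Im z * Im z).

Declare Scope C_scope.
Delimit Scope C_scope with Cx.
Infix "+" := Cadd : C_scope.
Infix "-" := Csub : C_scope.
Infix "*" := Cmul : C_scope.
Infix "/" := Cdiv : C_scope.
Notation "- z" := (Copp z) : C_scope.

Definition Cexp (z : Cx) : Cx := mkC (exp (Re z) * cos (Im z)) (exp (Re z) * sin (Im z)).
Definition Ccos (z : Cx) : Cx :=
  Cdiv (Cadd (Cexp (Cmul Ci z)) (Cexp (Copp (Cmul Ci z)))) (RtoC 2).

Definition Cprod_list (l : list Cx) : Cx := fold_right Cmul Cx1 l.
Fixpoint Cpow (z : Cx) (n : nat) : Cx :=
  match n with O => Cx1 | S k => Cmul z (Cpow z k) end.
Fixpoint poch (z : Cx) (n : nat) : Cx :=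
  match n with O => Cx1 | S k => Cmul (poch z k) (Cadd z (RtoC (INR k))) end.

Definition Cnatpow (n : nat) (z : Cx) : Cx := Cexp (Cmul z (RtoC (ln (INR n)))).

Definition Cseq_cv (u : nat -> Cx) (l : Cx) : Prop :=
  forall eps : R, eps > 0 -> exists N : nat, forall n : nat, (n >= N)%nat ->
    Cnorm (Csub (u n) l) < eps.

Definition Clim (u : nat -> Cx) : Cx :=
  epsilon (inhabits Cx0) (fun l => Cseq_cv u l).

Definition in_Zle0 (z : Cx) : Prop := exists m : nat, z = RtoC (- INR m).

(** Euler's Gamma function via the Gauss limit formula
    Gamma(z) = lim_{n->oo} n! n^z / (z (z+1) ... (z+n)),
    valid (the limit exists) for z not in Z_0^-. *)
Definition Gamma (z : Cx) : Cx :=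
  Clim (fun n => Cdiv (Cmul (RtoC (INR (Factorial.fact n))) (Cnatpow n z)) (poch z (S n))).

Definition pFq_term (alphas betas : list Cx) (z : Cx) (n : nat) : Cx :=
  Cdiv (Cmul (Cprod_list (map (fun a => poch a n) alphas)) (Cpow z n))
       (Cmul (Cprod_list (map (fun b => poch b n) betas)) (RtoC (INR (Factorial.fact n)))).

Fixpoint Csum (f : nat -> Cx) (n : nat) : Cx :=
  match n with O => f O | S k => Cadd (Csum f k) (f (S k)) end.

Definition pFq_sums (alphas betas : list Cx) (z : Cx) (l : Cx) : Prop :=
  Cseq_cv (Csum (pFq_term alphas betas z)) l.

Definition CPI : Cx := RtoC PI.

(* Main.v *)
(** With [h = v/2], [p = (a+b)/(2c)], [q = (a-b)/(2c)], [d = s/(2c)] the sigmas are [h -+ p],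
    [h -+ q] and [2 d^2 = p^2 + q^2].  By this last relation the n-th term of the series is a
    constant times [(v)_n / n!] times the sum of the four [1 / (sigma_j + n)], so everything
    reduces to Gauss' sum
      [sum_n (v)_n / (n! (n + s)) = Gamma(s) Gamma(1-v) / Gamma(1+s-v)].
    Its value is forced by the recursion [s S(s) = (1+s-v) S(s+1)] together with the behaviour
    of [S(s+m)] as [m -> oo], which by comparison is that of the explicit [S(1+m)].  The comparison
    converges for [-1/2 < Re v < 1]; smaller [Re v] follow from [S_{v-1}(s) = S_v(s) - S_v(s+1)].
    The values at [h - p] and [h + p] combine through the reflection formula, i.e. the
    sine product; the latter comes from [J_n(z) = int_0^(PI/2) cos(2zt) cos(t)^n dt], for which
    [(n^2 - 4z^2) J_n(z) = n(n-1) J_{n-2}(z)] and [J_n(z) / J_n(0) -> 1]. *)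
From Stdlib Require Import Reals Lra Lia Psatz List Factorial.
From Coquelicot Require Import Rcomplements Hierarchy Continuity Derive AutoDerive.
From Coquelicot Require Import RInt RInt_analysis.
Require Import Defs.
Import ListNotations.
Open Scope R_scope.

(** * The field of complex numbers and limits *)

(** Gauss' sum is proved with 1/Gamma in place of Gamma. For s one of the sigmas, 1 + s - v is one
    minus the opposite sigma, and since c is complex that sigma can be a positive integer; Gamma
    then has a pole where the sum merely vanishes. The limit defining 1/Gamma exists everywhere, and
    its recursion and reflection formula hold without exceptions; Gamma itself returns only at
    points outside Z_0^-. The descent in v is forced by the comparison: a termwise estimate of
    S(s+1+m) - S(1+m) cannot beat the size m^(-2) of its first term, while S(1+m) has order m^(Re v
    - 1). Direct comparison thus requires Re v > -1; the strip Re v > -1/2 leaves room for a simple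
    splitting of exponents. The condition cos(v pi/2) <> 0 has a second use: together with v/2
    outside Z_0^- it keeps v outside Z_0^-, so that Gamma(v) is a true value and division by sin(v
    pi) is legitimate. *)

Lemma Cx_ext (z w : Cx) : Re z = Re w -> Im z = Im w -> z = w.
Proof. destruct z, w; simpl; intros -> ->; reflexivity. Qed.

Ltac cx := apply Cx_ext; simpl; try ring; try lra.

Lemma Cx1_neq0 : Cx1 <> Cx0.
Proof. intros H; apply (f_equal Re) in H; simpl in H; lra. Qed.

Lemma Cx_norm2_pos (z : Cx) : z <> Cx0 -> 0 < Re z * Re z + Im z * Im z.
Proof.
  intros H.
  destruct (Req_dec (Re z) 0) as [E|E], (Req_dec (Im z) 0) as [F|F]; try nra.
  exfalso; apply H; apply Cx_ext; simpl; assumption.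
Qed.

Lemma Cx_field_theory :
  field_theory Cx0 Cx1 Cadd Cmul Csub Copp Cdiv Cinv (@eq Cx).
Proof.
  constructor; [constructor; intros; cx | apply Cx1_neq0 | reflexivity |].
  intros p H; apply Cx_norm2_pos in H; apply Cx_ext; simpl; field; lra.
Qed.
Add Field Cx_field : Cx_field_theory.

Lemma RtoC_add (x y : R) : RtoC (x + y) = (RtoC x + RtoC y)%Cx.
Proof. cx. Qed.
Lemma RtoC_mul (x y : R) : RtoC (x * y) = (RtoC x * RtoC y)%Cx.
Proof. cx. Qed.
Lemma RtoC_opp (x : R) : RtoC (- x) = (- RtoC x)%Cx.
Proof. cx. Qed.
Lemma RtoC_inj (x y : R) : RtoC x = RtoC y -> x = y.
Proof. intros H; exact (f_equal Re H). Qed.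
Lemma RtoC_neq0 (x : R) : x <> 0 -> RtoC x <> Cx0.
Proof. intros H E; apply H, RtoC_inj, E. Qed.
Lemma RtoC_inv (x : R) : RtoC (/ x) = Cinv (RtoC x).
Proof.
  destruct (Req_dec x 0) as [->|H].
  - apply Cx_ext; simpl; unfold Rdiv; rewrite ?Rinv_0; ring.
  - apply Cx_ext; simpl; field; lra.
Qed.
Lemma RtoC_S (n : nat) : RtoC (INR (S n)) = (RtoC (INR n) + Cx1)%Cx.
Proof. rewrite S_INR; cx. Qed.
(** [ring] and [field] on [Cx] see [RtoC 2] as an opaque atom; rewriting with this equation exposes
    its value. *)
Lemma RtoC_2 : RtoC 2 = (Cx1 + Cx1)%Cx.
Proof. cx. Qed.
Lemma RtoC_S_neq0 (n : nat) : RtoC (INR (S n)) <> Cx0.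
Proof. apply RtoC_neq0, not_0_INR; lia. Qed.
Lemma RtoC_fact_neq0 (n : nat) : RtoC (INR (fact n)) <> Cx0.
Proof. apply RtoC_neq0, INR_fact_neq_0. Qed.

Lemma Cmul_integral (z w : Cx) : (z * w)%Cx = Cx0 -> z = Cx0 \/ w = Cx0.
Proof.
  intros H; destruct (Req_dec (Re z * Re z + Im z * Im z) 0) as [E|E].
  - left; apply Cx_ext; simpl; nra.
  - right. assert (Hz : z <> Cx0) by (intros ->; simpl in E; lra).
    transitivity (Cinv z * (z * w))%Cx; [field; auto | rewrite H; ring].
Qed.
Lemma Cmul_neq0 (z w : Cx) : z <> Cx0 -> w <> Cx0 -> (z * w)%Cx <> Cx0.
Proof. intros Hz Hw H; destruct (Cmul_integral _ _ H); auto. Qed.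
Lemma Cinv_neq0 (z : Cx) : z <> Cx0 -> Cinv z <> Cx0.
Proof.
  intros Hz H; apply Cx1_neq0.
  transitivity (z * Cinv z)%Cx; [field; auto | rewrite H; ring].
Qed.

Lemma Cnorm_ge0 (z : Cx) : 0 <= Cnorm z.
Proof. apply sqrt_pos. Qed.
Lemma Cnorm_sqr (z : Cx) : Cnorm z * Cnorm z = Re z * Re z + Im z * Im z.
Proof. apply sqrt_sqrt; nra. Qed.
Lemma Cnorm_le_of_sqr (z : Cx) (r : R) :
  0 <= r -> Re z * Re z + Im z * Im z <= r * r -> Cnorm z <= r.
Proof. intros Hr H; apply Rsqr_incr_0_var; auto; unfold Rsqr; rewrite Cnorm_sqr; lra. Qed.
Lemma Cnorm_mul (z w : Cx) : Cnorm (z * w)%Cx = Cnorm z * Cnorm w.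
Proof.
  unfold Cnorm; rewrite <- sqrt_mult by nra; f_equal; simpl; ring.
Qed.
Lemma Cnorm_add (z w : Cx) : Cnorm (z + w)%Cx <= Cnorm z + Cnorm w.
Proof.
  pose proof (Cnorm_ge0 z); pose proof (Cnorm_ge0 w).
  apply Cnorm_le_of_sqr; [lra|].
  assert (Re z * Re w + Im z * Im w <= Cnorm z * Cnorm w).
  { apply Rsqr_incr_0_var; [|nra]. unfold Rsqr.
    replace (Cnorm z * Cnorm w * (Cnorm z * Cnorm w))
      with ((Cnorm z * Cnorm z) * (Cnorm w * Cnorm w)) by ring.
    rewrite !Cnorm_sqr. pose proof (Rle_0_sqr (Re z * Im w - Im z * Re w)).
    unfold Rsqr in *; nra. }
  pose proof (Cnorm_sqr z); pose proof (Cnorm_sqr w); simpl; nra.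
Qed.
Lemma Cnorm_opp (z : Cx) : Cnorm (- z)%Cx = Cnorm z.
Proof. unfold Cnorm; f_equal; simpl; ring. Qed.
Lemma Cnorm_sub_sym (z w : Cx) : Cnorm (z - w)%Cx = Cnorm (w - z)%Cx.
Proof. rewrite <- Cnorm_opp; f_equal; ring. Qed.
Lemma Cnorm_sub_ge (z w : Cx) : Cnorm z - Cnorm w <= Cnorm (z - w)%Cx.
Proof.
  pose proof (Cnorm_add (z - w)%Cx w) as H.
  replace (z - w + w)%Cx with z in H by ring; lra.
Qed.
Lemma Cnorm_RtoC (x : R) : Cnorm (RtoC x) = Rabs x.
Proof.
  unfold Cnorm; simpl. replace (x * x + 0 * 0) with (Rsqr x) by (unfold Rsqr; ring).
  apply sqrt_Rsqr_abs.
Qed.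
Lemma Cnorm_0 : Cnorm Cx0 = 0.
Proof. unfold Cx0; rewrite Cnorm_RtoC; apply Rabs_R0. Qed.
Lemma Cnorm_1 : Cnorm Cx1 = 1.
Proof. unfold Cx1; rewrite Cnorm_RtoC; apply Rabs_R1. Qed.
Lemma Cnorm_pos (z : Cx) : z <> Cx0 -> 0 < Cnorm z.
Proof. intros H; apply sqrt_lt_R0, Cx_norm2_pos, H. Qed.
Lemma Cnorm_inv (z : Cx) : z <> Cx0 -> Cnorm (Cinv z) = / Cnorm z.
Proof.
  intros H. pose proof (Cnorm_pos z H).
  apply Rmult_eq_reg_l with (Cnorm z); [|lra].
  rewrite <- Cnorm_mul, Rinv_r by lra.
  replace (z * Cinv z)%Cx with Cx1 by (field; auto). apply Cnorm_1.
Qed.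
Lemma Rabs_Re_le (z : Cx) : Rabs (Re z) <= Cnorm z.
Proof.
  pose proof (Cnorm_sqr z); pose proof (Cnorm_ge0 z).
  apply Rabs_le; nra.
Qed.
Lemma Rabs_Im_le (z : Cx) : Rabs (Im z) <= Cnorm z.
Proof.
  pose proof (Cnorm_sqr z); pose proof (Cnorm_ge0 z).
  apply Rabs_le; nra.
Qed.
Lemma Cnorm_le_Rabs (z : Cx) : Cnorm z <= Rabs (Re z) + Rabs (Im z).
Proof.
  pose proof (Rabs_pos (Re z)); pose proof (Rabs_pos (Im z)).
  apply Cnorm_le_of_sqr; [lra|].
  assert (forall x, x * x = Rabs x * Rabs x) as E
    by (intros x; rewrite <- Rabs_mult; symmetry; apply Rabs_pos_eq; nra).
  rewrite (E (Re z)), (E (Im z)); nra.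
Qed.

Lemma Cseq_cv_components (u : nat -> Cx) (l : Cx) :
  Cseq_cv u l <->
  Un_cv (fun n => Re (u n)) (Re l) /\ Un_cv (fun n => Im (u n)) (Im l).
Proof.
  split.
  - intros H; split; intros e He; destruct (H e He) as [N HN]; exists N; intros n Hn;
      eapply Rle_lt_trans; try apply (HN n Hn); unfold Rdist;
      [apply (Rabs_Re_le (u n - l)%Cx) | apply (Rabs_Im_le (u n - l)%Cx)].
  - intros [H1 H2] e He.
    destruct (H1 (e / 2)) as [N1 HN1]; [lra|]; destruct (H2 (e / 2)) as [N2 HN2]; [lra|].
    exists (max N1 N2); intros n Hn.
    eapply Rle_lt_trans; [apply Cnorm_le_Rabs|].
    specialize (HN1 n ltac:(lia)); specialize (HN2 n ltac:(lia)).
    unfold Rdist in *. simpl. unfold Rminus in *. lra.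
Qed.

Lemma Cseq_cv_unique (u : nat -> Cx) (l l' : Cx) : Cseq_cv u l -> Cseq_cv u l' -> l = l'.
Proof.
  rewrite !Cseq_cv_components; intros [H1 H2] [H3 H4].
  apply Cx_ext; eapply UL_sequence; eauto.
Qed.
Lemma Clim_eq (u : nat -> Cx) (l : Cx) : Cseq_cv u l -> Clim u = l.
Proof.
  intros H; apply (Cseq_cv_unique u); auto.
  unfold Clim; apply ClassicalEpsilon.epsilon_spec; eauto.
Qed.
Lemma Cseq_cv_ext_from (N : nat) (u w : nat -> Cx) (l : Cx) :
  (forall n, (N <= n)%nat -> u n = w n) -> Cseq_cv u l -> Cseq_cv w l.
Proof.
  intros E H e He; destruct (H e He) as [M HM].
  exists (max M N); intros n Hn; rewrite <- E by lia; apply HM; lia.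
Qed.
Lemma Cseq_cv_ext (u w : nat -> Cx) (l : Cx) :
  (forall n, u n = w n) -> Cseq_cv u l -> Cseq_cv w l.
Proof. intros E; apply (Cseq_cv_ext_from 0); auto. Qed.
Lemma Cseq_cv_const (l : Cx) : Cseq_cv (fun _ => l) l.
Proof.
  intros e He; exists O; intros; replace (l - l)%Cx with Cx0 by ring; rewrite Cnorm_0; lra.
Qed.
Lemma Cseq_cv_add (u w : nat -> Cx) (l m : Cx) :
  Cseq_cv u l -> Cseq_cv w m -> Cseq_cv (fun n => u n + w n)%Cx (l + m)%Cx.
Proof.
  rewrite !Cseq_cv_components; intros [H1 H2] [H3 H4].
  split; apply CV_plus; auto.
Qed.
Lemma Cseq_cv_mul (u w : nat -> Cx) (l m : Cx) :
  Cseq_cv u l -> Cseq_cv w m -> Cseq_cv (fun n => u n * w n)%Cx (l * m)%Cx.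
Proof.
  rewrite !Cseq_cv_components; intros [H1 H2] [H3 H4].
  split; simpl; [apply CV_minus | apply CV_plus]; apply CV_mult; auto.
Qed.
Lemma Cseq_cv_scal (z : Cx) (u : nat -> Cx) (l : Cx) :
  Cseq_cv u l -> Cseq_cv (fun n => z * u n)%Cx (z * l)%Cx.
Proof. intros; apply Cseq_cv_mul; auto using Cseq_cv_const. Qed.
Lemma Cseq_cv_sub (u w : nat -> Cx) (l m : Cx) :
  Cseq_cv u l -> Cseq_cv w m -> Cseq_cv (fun n => u n - w n)%Cx (l - m)%Cx.
Proof.
  intros H K; apply (Cseq_cv_scal (- Cx1)%Cx) in K.
  eapply Cseq_cv_ext; [|replace (l - m)%Cx with (l + - Cx1 * m)%Cx by ring;
    apply (Cseq_cv_add _ _ _ _ H K)].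
  intros n; simpl; ring.
Qed.
Lemma Cseq_cv_S (u : nat -> Cx) (l : Cx) : Cseq_cv u l <-> Cseq_cv (fun n => u (S n)) l.
Proof.
  split; intros H e He; destruct (H e He) as [N HN].
  - exists N; intros n Hn; apply HN; lia.
  - exists (S N); intros [|n] Hn; [lia|]; apply HN; lia.
Qed.
Lemma Cseq_cv_squeeze (u : nat -> Cx) (l : Cx) (e : nat -> R) (N : nat) :
  (forall n, (N <= n)%nat -> Cnorm (u n - l)%Cx <= e n) -> Un_cv e 0 -> Cseq_cv u l.
Proof.
  intros H He d Hd; destruct (He d Hd) as [M HM]; exists (max M N); intros n Hn.
  eapply Rle_lt_trans; [apply H; lia|].
  specialize (HM n ltac:(lia)); unfold Rdist in HM.
  rewrite Rminus_0_r in HM; pose proof (Rle_abs (e n)); lra.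
Qed.
Lemma Cnorm_lim_le (u : nat -> Cx) (l : Cx) (B : R) :
  (forall n, Cnorm (u n) <= B) -> Cseq_cv u l -> Cnorm l <= B.
Proof.
  intros H Hl; apply Rnot_lt_le; intros HB.
  destruct (Hl (Cnorm l - B)) as [N HN]; [lra|].
  specialize (HN N (le_n N)); specialize (H N).
  rewrite Cnorm_sub_sym in HN; pose proof (Cnorm_sub_ge l (u N)); lra.
Qed.

Lemma Cseq_cv_bounded (u : nat -> Cx) (l : Cx) :
  Cseq_cv u l -> exists B, 0 < B /\ forall n, Cnorm (u n) <= B.
Proof.
  rewrite Cseq_cv_components; intros [H1 H2].
  destruct (maj_by_pos _ (exist _ _ H1)) as [B1 [P1 HB1]].
  destruct (maj_by_pos _ (exist _ _ H2)) as [B2 [P2 HB2]].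
  exists (B1 + B2); split; [lra|]; intros n.
  specialize (HB1 n); specialize (HB2 n); simpl in *.
  pose proof (Cnorm_le_Rabs (u n)); lra.
Qed.

(** The hypothesis makes [e] and [u + e] decreasing and [u - e] increasing. So [u + e] is bounded
    below by [u O - e O], and [u] is the difference of two convergent sequences. *)
Lemma Un_cv_telescoping_bound (u e : nat -> R) :
  (forall n, 0 <= e n) -> (forall n, Rabs (u (S n) - u n) <= e n - e (S n)) ->
  exists l, Un_cv u l.
Proof.
  intros He H.
  assert (D : forall n, -(e n - e (S n)) <= u (S n) - u n <= e n - e (S n)).
  { intros n; specialize (H n).
    pose proof (Rle_abs (u (S n) - u n)); pose proof (Rle_abs (- (u (S n) - u n))).
    rewrite Rabs_Ropp in *; lra. }
  assert (exists l, Un_cv e l) as [l1 C1].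
  { destruct (decreasing_cv e) as [l Hl]; [| |exists l; exact Hl].
    - intros n; specialize (D n); lra.
    - exists 0; intros x [n ->]; unfold opp_seq; specialize (He n); lra. }
  assert (exists l, Un_cv (fun n => u n + e n) l) as [l2 C2].
  { destruct (decreasing_cv (fun n => u n + e n)) as [l Hl]; [| |exists l; exact Hl].
    - intros n; specialize (D n); lra.
    - exists (- (u O - e O)); intros x [n ->]; unfold opp_seq.
      assert (u O - e O <= u n - e n); [|specialize (He n); lra].
      induction n; [lra|]; specialize (D n); lra. }
  exists (l2 - l1).
  intros eps Heps; destruct (CV_minus _ _ _ _ C2 C1 eps Heps) as [N HN].
  exists N; intros n Hn; specialize (HN n Hn).
  replace (u n + e n - e n) with (u n) in HN by ring; exact HN.
Qed.

Lemma Cseq_cv_telescoping_bound (u : nat -> Cx) (e : nat -> R) (N : nat) :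
  (forall n, (N <= n)%nat -> 0 <= e n) ->
  (forall n, (N <= n)%nat -> Cnorm (u (S n) - u n)%Cx <= e n - e (S n)) ->
  exists l, Cseq_cv u l.
Proof.
  intros He H.
  destruct (Un_cv_telescoping_bound (fun n => Re (u (n + N)%nat)) (fun n => e (n + N)%nat))
    as [l1 H1].
  { intros n; apply He; lia. }
  { intros n; eapply Rle_trans; [|apply (H (n + N)%nat); lia].
    apply (Rabs_Re_le (u (S (n + N)) - u (n + N)%nat)%Cx). }
  destruct (Un_cv_telescoping_bound (fun n => Im (u (n + N)%nat)) (fun n => e (n + N)%nat))
    as [l2 H2].
  { intros n; apply He; lia. }
  { intros n; eapply Rle_trans; [|apply (H (n + N)%nat); lia].
    apply (Rabs_Im_le (u (S (n + N)) - u (n + N)%nat)%Cx). }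
  exists (mkC l1 l2); apply Cseq_cv_components; split;
    apply (CV_shift (fun n => Re (u n)) N) || apply (CV_shift (fun n => Im (u n)) N); assumption.
Qed.

(** * Infinite products *)

Lemma Cexp_add (z w : Cx) : Cexp (z + w)%Cx = (Cexp z * Cexp w)%Cx.
Proof. apply Cx_ext; simpl; rewrite exp_plus, ?cos_plus, ?sin_plus; ring. Qed.
Lemma Cexp_0 : Cexp Cx0 = Cx1.
Proof. apply Cx_ext; simpl; rewrite exp_0, ?cos_0, ?sin_0; ring. Qed.
Lemma Cexp_RtoC (x : R) : Cexp (RtoC x) = RtoC (exp x).
Proof. apply Cx_ext; simpl; rewrite ?cos_0, ?sin_0; ring. Qed.
Lemma Cnorm_Cexp (z : Cx) : Cnorm (Cexp z) = exp (Re z).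
Proof.
  pose proof (exp_pos (Re z)).
  unfold Cnorm; simpl.
  replace (exp (Re z) * cos (Im z) * (exp (Re z) * cos (Im z)) +
           exp (Re z) * sin (Im z) * (exp (Re z) * sin (Im z)))
    with (Rsqr (exp (Re z)) * (Rsqr (sin (Im z)) + Rsqr (cos (Im z))))
    by (unfold Rsqr; ring).
  rewrite sin2_cos2, Rmult_1_r; apply sqrt_Rsqr; lra.
Qed.
Lemma Cexp_opp (z : Cx) : (Cexp z * Cexp (- z)%Cx)%Cx = Cx1.
Proof. rewrite <- Cexp_add, <- Cexp_0; f_equal; ring. Qed.
Lemma Cexp_neq0 (z : Cx) : Cexp z <> Cx0.
Proof.
  intros H; apply Cx1_neq0; rewrite <- (Cexp_opp z), H; ring.
Qed.

(** The intermediate point of the mean value theorem is kept, because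
    [sin y - y = - y * (1 - cos t)] is then visibly of higher order. *)
Lemma sin_eq_mul_cos (y : R) : exists t, Rabs t <= Rabs y /\ sin y = y * cos t.
Proof.
  destruct (MVT_gen sin 0 y cos) as [t [Ht E]].
  - intros x _; auto_derive; [auto|ring].
  - intros x _; apply continuity_sin.
  - exists t; split.
    + unfold Rmin, Rmax in Ht; destruct (Rle_dec 0 y).
      * rewrite !Rabs_pos_eq; lra.
      * rewrite !Rabs_left1; lra.
    + rewrite sin_0 in E; lra.
Qed.
Lemma Rabs_sin_le (y : R) : Rabs (sin y) <= Rabs y.
Proof.
  destruct (sin_eq_mul_cos y) as [t [_ ->]]; rewrite Rabs_mult.
  pose proof (Rabs_pos y).
  assert (Rabs (cos t) <= 1) by (apply Rabs_le, COS_bound). nra.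
Qed.
Lemma Rabs_sqr (x : R) : Rabs x * Rabs x = x * x.
Proof. rewrite <- Rabs_mult; apply Rabs_pos_eq; nra. Qed.
Lemma one_minus_cos_bound (y : R) : 0 <= 1 - cos y <= y * y / 2.
Proof.
  split; [pose proof (COS_bound y); lra|].
  replace y with (2 * (y / 2)) at 1 by field.
  rewrite cos_2a_sin. pose proof (Rabs_sin_le (y / 2)).
  pose proof (Rabs_pos (sin (y / 2))).
  pose proof (Rabs_sqr (sin (y / 2))); pose proof (Rabs_sqr (y / 2)). nra.
Qed.
(** For the upper bound, [1 - x <= exp (- x)] is multiplied by [exp x], which gives
    [exp x * (1 - x) <= 1]. *)
Lemma exp_sub_one_sub_id_bound (x : R) : Rabs x <= 1 / 2 -> 0 <= exp x - 1 - x <= 2 * (x * x).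
Proof.
  intros H; apply Rabs_le_between in H.
  pose proof (exp_ineq1_le x); pose proof (exp_ineq1_le (- x)).
  split; [lra|].
  assert (exp x * exp (- x) = 1) by (rewrite <- exp_plus, Rplus_opp_r; apply exp_0).
  pose proof (exp_pos x).
  assert (exp x * (1 - x) <= 1) by nra.
  assert (exp x <= 2) by nra. nra.
Qed.

(** By components, for u = x + iy: the real part is (e^x - 1 - x) - e^x (1 - cos y), the imaginary
    part (e^x - 1) sin y - y (1 - cos t), and every summand is quadratic in (x, y). *)
Lemma Cexp_bound (u : Cx) : Cnorm u <= 1 / 2 ->
  Cnorm (Cexp u - Cx1 - u)%Cx <= 8 * (Cnorm u * Cnorm u).
Proof.
  intros H. rewrite Cnorm_sqr.
  pose proof (Rabs_Re_le u) as Hx; pose proof (Rabs_Im_le u) as Hy.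
  eapply Rle_trans; [apply Cnorm_le_Rabs|].
  destruct u as [x y]; simpl in *.
  destruct (exp_sub_one_sub_id_bound x ltac:(lra)) as [E1 E2].
  pose proof (one_minus_cos_bound y) as C.
  destruct (sin_eq_mul_cos y) as [t [Ht Es]].
  pose proof (one_minus_cos_bound t) as Ct.
  pose proof (Rabs_sqr t); pose proof (Rabs_sqr y); pose proof (Rabs_sqr x).
  pose proof (Rabs_pos t); pose proof (Rabs_pos y); pose proof (Rabs_pos x).
  assert (Hxx : Rabs x <= 1 / 2) by lra. assert (Hyy : Rabs y <= 1 / 2) by lra.
  pose proof (exp_pos x).
  assert (exp x <= 2) by (apply Rabs_le_between in Hxx; nra).
  assert (T1 : Rabs (exp x * cos y + - (1) + - x) <= 2 * (x * x) + y * y).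
  { replace (exp x * cos y + - (1) + - x) with ((exp x - 1 - x) - exp x * (1 - cos y)) by ring.
    apply Rabs_le; nra. }
  assert (T2 : Rabs (exp x * sin y + - 0 + - y) <= 2 * (x * x) + 4 * (y * y)).
  { replace (exp x * sin y + - 0 + - y) with ((exp x - 1) * sin y - y * (1 - cos t))
      by (rewrite Es; ring).
    eapply Rle_trans; [apply Rabs_triang|]. rewrite Rabs_Ropp, !Rabs_mult.
    pose proof (Rabs_sin_le y) as S.
    assert (Rabs (exp x - 1) <= 2 * Rabs x).
    { replace (exp x - 1) with ((exp x - 1 - x) + x) by ring.
      eapply Rle_trans; [apply Rabs_triang|].
      rewrite (Rabs_pos_eq (exp x - 1 - x)) by lra. nra. }
    rewrite (Rabs_pos_eq (1 - cos t)) by lra.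
    pose proof (Rabs_pos (exp x - 1)); pose proof (Rabs_pos (sin y)).
    assert (Rabs (exp x - 1) * Rabs (sin y) <= 2 * Rabs x * Rabs y)
      by (apply Rmult_le_compat; lra).
    assert (1 - cos t <= Rabs y) by nra.
    pose proof (Rle_0_sqr (Rabs x - Rabs y)) as Q; unfold Rsqr in Q.
    assert (Rabs y * (1 - cos t) <= Rabs y * Rabs y) by (apply Rmult_le_compat_l; lra).
    nra. }
  eapply Rle_trans; [apply Rplus_le_compat; [exact T1|exact T2]|]. nra.
Qed.

(** The terms of order 1/(n+1) in (1 + z/(n+1)) exp(-zd) cancel when d = 1/(n+1) + O(1/n^2). The
    number [d] is left free because two logarithm steps are used: ln(n+1) - ln n for Gamma and
    ln(n+2) - ln(n+1) for the coefficients (v)_n / n!. *)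
Lemma gauss_factor_bound (z : Cx) : exists C, 0 < C /\ exists N : nat, forall (n : nat) (d : R),
  (N <= n)%nat -> Rabs (d - / INR (S n)) <= 2 / (INR (S n) * INR (S n)) ->
  Cnorm ((Cx1 + z * RtoC (/ INR (S n))) * Cexp (- (z * RtoC d))%Cx - Cx1)%Cx
    <= C / (INR (S n) * INR (S n)).
Proof.
  set (m := Cnorm z). assert (Hm : 0 <= m) by apply Cnorm_ge0.
  exists ((1 + m) * (72 * (m * m)) + 3 * (m * m) + 2 * m + 1); split; [nra|].
  (* Beyond this threshold [6 * (m * w) <= 1], so the exponent has norm at most
     [3 * (m * w) <= 1 / 2], the range of [Cexp_bound]; its constant 8 times 3^2 is the 72 above. *)
  destruct (INR_unbounded (6 * m + 1)) as [N HN]; exists N; intros n d Hn Hd.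
  assert (Hn1 : INR (S n) >= 6 * m + 1).
  { apply le_INR in Hn; rewrite S_INR; lra. }
  set (x := INR (S n)) in *.
  assert (Hx1 : 1 <= x) by lra.
  assert (Hw : 0 < / x) by (apply Rinv_0_lt_compat; lra).
  assert (Hw1 : / x * x = 1) by (apply Rinv_l; lra).
  replace (2 / (x * x)) with (2 * (/ x * / x)) in Hd by (field; lra).
  match goal with |- _ <= ?K / _ => replace (K / (x * x)) with (K * (/ x * / x)) by (field; lra) end.
  set (w := / x) in *.
  assert (Hw2 : w <= 1) by nra.
  assert (Hmw : 6 * (m * w) <= 1) by nra.
  assert (Hdw : Rabs d <= 3 * w).
  { replace d with ((d - w) + w) by ring. eapply Rle_trans; [apply Rabs_triang|].
    rewrite (Rabs_pos_eq w) by lra. nra. }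
  pose proof (Rabs_pos d).
  set (u := (- (z * RtoC d))%Cx).
  assert (Hu : Cnorm u <= 3 * (m * w)).
  { unfold u; rewrite Cnorm_opp, Cnorm_mul, Cnorm_RtoC; fold m; nra. }
  assert (HE : Cnorm (Cexp u - Cx1 - u)%Cx <= 72 * (m * m) * (w * w)).
  { eapply Rle_trans; [apply Cexp_bound; lra|].
    pose proof (Cnorm_ge0 u).
    assert (Cnorm u * Cnorm u <= (3 * (m * w)) * (3 * (m * w))) by (apply Rmult_le_compat; lra).
    lra. }
  (* Three second-order pieces: the remainder of the exponential, the product of the two linear
     terms, and the discrepancy between [d] and [w]. *)
  replace ((Cx1 + z * RtoC w) * Cexp u - Cx1)%Cx with
    ((Cx1 + z * RtoC w) * (Cexp u - Cx1 - u) + (z * RtoC w * u + - (z * RtoC (d - w))))%Cx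
    by (unfold u, Rminus; rewrite RtoC_add, RtoC_opp; ring).
  assert (Cnorm (Cx1 + z * RtoC w)%Cx <= 1 + m).
  { eapply Rle_trans; [apply Cnorm_add|].
    rewrite Cnorm_1, Cnorm_mul, Cnorm_RtoC, (Rabs_pos_eq w) by lra; fold m; nra. }
  eapply Rle_trans; [apply Cnorm_add|].
  rewrite Cnorm_mul.
  assert (A1 : Cnorm (Cx1 + z * RtoC w)%Cx * Cnorm (Cexp u - Cx1 - u)%Cx
               <= (1 + m) * (72 * (m * m) * (w * w)))
    by (apply Rmult_le_compat; auto using Cnorm_ge0).
  assert (A2 : Cnorm (z * RtoC w * u + - (z * RtoC (d - w)))%Cx <= 3 * (m * m) * (w * w) + 2 * m * (w * w)).
  { eapply Rle_trans; [apply Cnorm_add|].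
    rewrite Cnorm_opp, !Cnorm_mul, !Cnorm_RtoC, (Rabs_pos_eq w) by lra; fold m.
    assert (m * w * Cnorm u <= m * w * (3 * (m * w))) by (apply Rmult_le_compat_l; nra).
    assert (m * Rabs (d - w) <= m * (2 * (w * w))) by (apply Rmult_le_compat_l; lra).
    lra. }
  nra.
Qed.

Lemma inv_sqr_le_telescope (n : nat) : (1 <= n)%nat ->
  / (INR (S n) * INR (S n)) <= / INR n - / INR (S n).
Proof.
  intros H; apply le_INR in H; simpl INR in H; rewrite S_INR; set (x := INR n) in *.
  replace (/ x - / (x + 1)) with (/ (x * (x + 1))) by (field; lra).
  apply Rinv_le_contravar; nra.
Qed.

(** Since 1/(n+1)^2 <= 1/n - 1/(n+1), the quantity |p_n| exp(C/n) does not increase, so [p] is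
    bounded; its increments are then dominated by a multiple of 1/n - 1/(n+1). Whether the limit
    vanishes is left open here. *)
Lemma Cseq_cv_infinite_product (p q : nat -> Cx) (C : R) (N : nat) : 0 < C ->
  (forall n, (N <= n)%nat -> p (S n) = (p n * q n)%Cx) ->
  (forall n, (N <= n)%nat -> Cnorm (q n - Cx1)%Cx <= C / (INR (S n) * INR (S n))) ->
  exists l, Cseq_cv p l.
Proof.
  intros HC Hp Hq.
  (* Starting at [S N] ensures n >= 1, where [/ INR n] is a true inverse. *)
  set (M := S N).
  assert (HM : forall n, (M <= n)%nat -> Cnorm (q n - Cx1)%Cx <= C * (/ INR n - / INR (S n))).
  { intros n Hn; eapply Rle_trans; [apply Hq; unfold M in Hn; lia|].
    apply Rmult_le_compat_l; [lra|]; apply inv_sqr_le_telescope; unfold M in Hn; lia. }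
  assert (Hpos : forall n, (M <= n)%nat -> 0 < / INR n).
  { intros n Hn; apply Rinv_0_lt_compat, lt_0_INR; unfold M in Hn; lia. }
  set (B := Cnorm (p M) * exp (C * / INR M)).
  assert (HB : forall n, (M <= n)%nat -> Cnorm (p n) * exp (C * / INR n) <= B).
  { induction 1 as [|n Hn IH]; [apply Rle_refl|].
    eapply Rle_trans; [|apply IH].
    rewrite Hp by (unfold M in Hn; lia). rewrite Cnorm_mul.
    specialize (HM n Hn).
    assert (Cnorm (q n) <= exp (C * (/ INR n - / INR (S n)))).
    { eapply Rle_trans; [|apply exp_ineq1_le].
      replace (q n) with (Cx1 + (q n - Cx1))%Cx by ring.
      eapply Rle_trans; [apply Cnorm_add|]; rewrite Cnorm_1; lra. }
    replace (C * / INR n) with (C * (/ INR n - / INR (S n)) + C * / INR (S n)) by ring.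
    rewrite exp_plus, <- !Rmult_assoc.
    apply Rmult_le_compat_r; [apply Rlt_le, exp_pos|].
    apply Rmult_le_compat_l; auto using Cnorm_ge0. }
  assert (HB' : forall n, (M <= n)%nat -> Cnorm (p n) <= B).
  { intros n Hn; eapply Rle_trans; [|apply HB, Hn].
    pose proof (Hpos n Hn). pose proof (Cnorm_ge0 (p n)).
    assert (0 < C * / INR n) by (apply Rmult_lt_0_compat; auto).
    pose proof (exp_ineq1_le (C * / INR n)). nra. }
  assert (HB0 : 0 <= B) by (eapply Rle_trans; [apply Cnorm_ge0 | apply (HB' M), le_n]).
  apply (Cseq_cv_telescoping_bound p (fun n => B * C * / INR n) M).
  - intros n Hn; specialize (Hpos n Hn); apply Rmult_le_pos; [nra|lra].
  - intros n Hn. rewrite Hp by (unfold M in Hn; lia).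
    replace (p n * q n - p n)%Cx with (p n * (q n - Cx1))%Cx by ring.
    rewrite Cnorm_mul. specialize (HM n Hn); specialize (HB' n Hn).
    replace (B * C * / INR n - B * C * / INR (S n))
      with (B * (C * (/ INR n - / INR (S n)))) by ring.
    apply Rmult_le_compat; auto using Cnorm_ge0.
Qed.

(** * The reciprocal Gamma function *)

Lemma poch_succ_l (z : Cx) (n : nat) : poch z (S n) = (z * poch (z + Cx1)%Cx n)%Cx.
Proof.
  induction n as [|n IH]; [cx|].
  change (poch z (S (S n))) with (poch z (S n) * (z + RtoC (INR (S n))))%Cx.
  rewrite IH, RtoC_S; simpl; ring.
Qed.
Lemma not_in_Zle0_add (z : Cx) (k : nat) : ~ in_Zle0 z -> (z + RtoC (INR k))%Cx <> Cx0.
Proof.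
  intros H E; apply H; exists k. rewrite RtoC_opp.
  transitivity (z + RtoC (INR k) - RtoC (INR k))%Cx; [ring | rewrite E; ring].
Qed.
Lemma not_in_Zle0_succ (z : Cx) : ~ in_Zle0 z -> ~ in_Zle0 (z + Cx1)%Cx.
Proof.
  intros H [m E]; apply H; exists (S m).
  transitivity (z + Cx1 - Cx1)%Cx; [ring | rewrite E, !RtoC_opp, RtoC_S; ring].
Qed.
Lemma not_in_Zle0_neq0 (z : Cx) : ~ in_Zle0 z -> z <> Cx0.
Proof.
  intros H E; apply (not_in_Zle0_add z 0 H); rewrite E; cx.
Qed.
Lemma not_in_Zle0_pred (z : Cx) : ~ in_Zle0 (Cx1 + z)%Cx -> z <> Cx0 -> ~ in_Zle0 z.
Proof.
  intros H Hz [[|m] E].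
  - apply Hz; rewrite E; cx.
  - apply H; exists m; rewrite E, !RtoC_opp, RtoC_S; ring.
Qed.
Lemma not_in_Zle0_Re_pos (z : Cx) : 0 < Re z -> ~ in_Zle0 z.
Proof. intros H [m ->]; simpl in H; pose proof (pos_INR m); lra. Qed.
Lemma poch_neq0 (z : Cx) (n : nat) : ~ in_Zle0 z -> poch z n <> Cx0.
Proof.
  intros H; induction n; simpl; [apply Cx1_neq0|].
  apply Cmul_neq0; auto using not_in_Zle0_add.
Qed.

Lemma Cnatpow_add (n : nat) (z w : Cx) : Cnatpow n (z + w)%Cx = (Cnatpow n z * Cnatpow n w)%Cx.
Proof. unfold Cnatpow; rewrite <- Cexp_add; f_equal; ring. Qed.
Lemma Cnatpow_1 (n : nat) : (1 <= n)%nat -> Cnatpow n Cx1 = RtoC (INR n).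
Proof.
  intros H; unfold Cnatpow.
  replace (Cx1 * RtoC (ln (INR n)))%Cx with (RtoC (ln (INR n))) by ring.
  rewrite Cexp_RtoC, exp_ln; [reflexivity | apply lt_0_INR; lia].
Qed.
Lemma Cnatpow_neq0 (n : nat) (z : Cx) : Cnatpow n z <> Cx0.
Proof. apply Cexp_neq0. Qed.
Lemma Cnorm_Cnatpow (n : nat) (z : Cx) : Cnorm (Cnatpow n z) = Rpower (INR n) (Re z).
Proof. unfold Cnatpow; rewrite Cnorm_Cexp; unfold Rpower; f_equal; simpl; ring. Qed.

Lemma ln_le_sub_1 (x : R) : 0 < x -> ln x <= x - 1.
Proof. intros H; pose proof (exp_ineq1_le (ln x)); rewrite exp_ln in *; lra. Qed.
Lemma ln_succ_bounds (x : R) : 0 < x -> / (x + 1) <= ln (x + 1) - ln x <= / x.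
Proof.
  intros H; rewrite <- ln_div by lra; split.
  - replace (ln ((x + 1) / x)) with (- ln (/ ((x + 1) / x)))
      by (rewrite ln_Rinv by (apply Rdiv_lt_0_compat; lra); ring).
    assert (0 < / ((x + 1) / x)) as P by (apply Rinv_0_lt_compat, Rdiv_lt_0_compat; lra).
    apply ln_le_sub_1 in P.
    replace (/ ((x + 1) / x) - 1) with (- / (x + 1)) in P by (field; lra). lra.
  - eapply Rle_trans; [apply ln_le_sub_1, Rdiv_lt_0_compat; lra|].
    right; field; lra.
Qed.
Lemma ln_step_bound (n : nat) : (1 <= n)%nat ->
  Rabs (ln (INR (S n)) - ln (INR n) - / INR (S n)) <= 2 / (INR (S n) * INR (S n)).
Proof.
  intros H; apply le_INR in H; simpl INR in H; rewrite S_INR; set (x := INR n) in *.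
  destruct (ln_succ_bounds x) as [H1 H2]; [lra|].
  rewrite Rabs_pos_eq by lra.
  apply Rle_trans with (/ x - / (x + 1)); [lra|].
  apply Rle_trans with (/ (x * (x + 1))); [right; field; lra|].
  apply Rmult_le_reg_r with (x * (x + 1) * (x + 1)); [nra|].
  field_simplify; nra.
Qed.
Lemma ln_step_bound_succ (n : nat) :
  Rabs (ln (INR (S (S n))) - ln (INR (S n)) - / INR (S n)) <= 2 / (INR (S n) * INR (S n)).
Proof.
  rewrite (S_INR (S n)). assert (1 <= INR (S n)) by (apply (le_INR 1); lia).
  set (x := INR (S n)) in *.
  destruct (ln_succ_bounds x) as [H1 H2]; [lra|].
  rewrite Rabs_left1 by lra.
  apply Rle_trans with (/ x - / (x + 1)); [lra|].
  apply Rle_trans with (/ (x * (x + 1))); [right; field; lra|].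
  apply Rmult_le_reg_r with (x * x * (x + 1)); [nra|].
  field_simplify; nra.
Qed.

Definition rGamma_seq (z : Cx) (n : nat) : Cx :=
  (poch z (S n) / (RtoC (INR (fact n)) * Cnatpow n z))%Cx.
(* 1 / Gamma is entire (it vanishes on Z_0^-), so its defining limit exists for every z. *)
Definition rGamma (z : Cx) : Cx := Clim (rGamma_seq z).

Definition gauss_factor (z : Cx) (n : nat) : Cx :=
  ((Cx1 + z * RtoC (/ INR (S n))) * Cexp (- (z * RtoC (ln (INR (S n)) - ln (INR n))))%Cx)%Cx.

Lemma rGamma_seq_step (z : Cx) (n : nat) :
  rGamma_seq z (S n) = (rGamma_seq z n * gauss_factor z n)%Cx.
Proof.
  unfold rGamma_seq, gauss_factor.
  change (poch z (S (S n))) with (poch z (S n) * (z + RtoC (INR (S n))))%Cx.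
  rewrite RtoC_inv.
  replace (fact (S n)) with (S n * fact n)%nat by reflexivity.
  rewrite mult_INR, RtoC_mul.
  assert (E : (Cexp (- (z * RtoC (ln (INR (S n)) - ln (INR n))))%Cx * Cnatpow (S n) z)%Cx
              = Cnatpow n z).
  { unfold Cnatpow; rewrite <- Cexp_add; f_equal.
    unfold Rminus; rewrite RtoC_add, RtoC_opp; ring. }
  rewrite <- E. pose proof (RtoC_S_neq0 n). pose proof (RtoC_fact_neq0 n).
  pose proof (Cnatpow_neq0 (S n) z).
  pose proof (Cexp_neq0 (- (z * RtoC (ln (INR (S n)) - ln (INR n))))%Cx).
  field; auto.
Qed.

Lemma rGamma_cv (z : Cx) : Cseq_cv (rGamma_seq z) (rGamma z).
Proof.
  destruct (gauss_factor_bound z) as [C [HC [N HN]]].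
  (* [S N] excludes n = 0, where [ln (INR n)] is only a default value and [ln_step_bound] does not
     apply. *)
  destruct (Cseq_cv_infinite_product (rGamma_seq z) (gauss_factor z) C (S N) HC) as [l Hl].
  - intros n _; apply rGamma_seq_step.
  - intros n Hn; apply HN; [lia|]; apply ln_step_bound; lia.
  - unfold rGamma; rewrite (Clim_eq _ _ Hl); exact Hl.
Qed.

Lemma rGamma_seq_neq0 (z : Cx) (n : nat) : ~ in_Zle0 z -> rGamma_seq z n <> Cx0.
Proof.
  intros H; unfold rGamma_seq, Cdiv.
  auto using Cmul_neq0, Cinv_neq0, poch_neq0, RtoC_fact_neq0, Cnatpow_neq0.
Qed.

Lemma Cinv_sub_1_bound (q : Cx) : Cnorm (q - Cx1)%Cx <= 1 / 2 ->
  q <> Cx0 /\ Cnorm (Cinv q - Cx1)%Cx <= 2 * Cnorm (q - Cx1)%Cx.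
Proof.
  intros H.
  assert (Hq : 1 / 2 <= Cnorm q).
  { pose proof (Cnorm_sub_ge Cx1 q) as K; rewrite Cnorm_sub_sym, Cnorm_1 in K; lra. }
  assert (Hq0 : q <> Cx0) by (intros ->; rewrite Cnorm_0 in Hq; lra).
  split; [exact Hq0|].
  replace (Cinv q - Cx1)%Cx with (Cinv q * - (q - Cx1))%Cx by (field; auto).
  rewrite Cnorm_mul, Cnorm_opp, Cnorm_inv by auto.
  apply Rmult_le_compat_r; [apply Cnorm_ge0|].
  apply Rle_trans with (/ (1 / 2)); [apply Rinv_le_contravar; lra | lra].
Qed.

(** The inverses form an infinite product as well, with factors 1/q; as soon as |q - 1| <= 1/2 one
    has |1/q - 1| <= 2 |q - 1|, so the same summable bound works with twice the constant. *)
Lemma Cinv_rGamma_seq_ex_cv (z : Cx) : ~ in_Zle0 z ->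
  exists l, Cseq_cv (fun n => Cinv (rGamma_seq z n)) l.
Proof.
  intros Hz.
  destruct (gauss_factor_bound z) as [C [HC [N HN]]].
  destruct (INR_unbounded (2 * C + 1)) as [M HM].
  assert (B : forall n, (S (max N M) <= n)%nat ->
    Cnorm (gauss_factor z n - Cx1)%Cx <= C / (INR (S n) * INR (S n)) /\
    Cnorm (gauss_factor z n - Cx1)%Cx <= 1 / 2).
  { intros n Hn.
    assert (H1 : Cnorm (gauss_factor z n - Cx1)%Cx <= C / (INR (S n) * INR (S n)))
      by (apply HN; [lia|]; apply ln_step_bound; lia).
    split; [exact H1|]. eapply Rle_trans; [exact H1|].
    assert (INR M <= INR (S n)) by (apply le_INR; lia).
    set (x := INR (S n)) in *.
    apply Rmult_le_reg_r with (x * x); [nra|]. unfold Rdiv; rewrite Rmult_assoc, Rinv_l by nra. nra. }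
  apply (Cseq_cv_infinite_product _ (fun n => Cinv (gauss_factor z n)) (2 * C) (S (max N M))).
  - lra.
  - intros n Hn; rewrite rGamma_seq_step.
    pose proof (rGamma_seq_neq0 z n Hz). destruct (Cinv_sub_1_bound _ (proj2 (B n Hn))).
    field; auto.
  - intros n Hn; destruct (B n Hn) as [H1 H2].
    destruct (Cinv_sub_1_bound _ H2). unfold Rdiv in *; lra.
Qed.

(** Two sequences with product 1 both converge, so their limits have product 1; this yields the
    non-vanishing of 1/Gamma without any formula for it. *)
Lemma Cinv_rGamma_seq_cv (z : Cx) : ~ in_Zle0 z ->
  rGamma z <> Cx0 /\ Cseq_cv (fun n => Cinv (rGamma_seq z n)) (Cinv (rGamma z)).
Proof.
  intros Hz; destruct (Cinv_rGamma_seq_ex_cv z Hz) as [g Hg].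
  assert (E : (g * rGamma z)%Cx = Cx1).
  { eapply Cseq_cv_unique; [apply Cseq_cv_mul; [exact Hg | apply rGamma_cv]|].
    eapply Cseq_cv_ext; [|apply Cseq_cv_const].
    intros n; cbv beta. pose proof (rGamma_seq_neq0 z n Hz). field; auto. }
  assert (H : rGamma z <> Cx0) by (intros H; apply Cx1_neq0; rewrite <- E, H; ring).
  split; [exact H|].
  replace (Cinv (rGamma z)) with g; [exact Hg|].
  transitivity (g * rGamma z * Cinv (rGamma z))%Cx; [field; auto | rewrite E; ring].
Qed.
Lemma rGamma_neq0 (z : Cx) : ~ in_Zle0 z -> rGamma z <> Cx0.
Proof. intros Hz; apply (Cinv_rGamma_seq_cv z Hz). Qed.
Lemma Gamma_eq_inv (z : Cx) : ~ in_Zle0 z -> Gamma z = Cinv (rGamma z).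
Proof.
  intros Hz; apply Clim_eq.
  eapply Cseq_cv_ext; [|apply (Cinv_rGamma_seq_cv z Hz)].
  intros n; unfold rGamma_seq.
  pose proof (poch_neq0 z (S n) Hz). pose proof (Cnatpow_neq0 n z).
  pose proof (RtoC_fact_neq0 n). field; auto.
Qed.

Lemma cv_inv_INR_S : Cseq_cv (fun n => RtoC (/ INR (S n))) Cx0.
Proof.
  apply (Cseq_cv_squeeze _ _ (fun n => / INR (S n)) 0).
  - intros n _. replace (RtoC (/ INR (S n)) - Cx0)%Cx with (RtoC (/ INR (S n))) by ring.
    rewrite Cnorm_RtoC, Rabs_pos_eq; [lra|]. apply Rlt_le, Rinv_0_lt_compat, lt_0_INR; lia.
  - intros e He; destruct (INR_unbounded (/ e)) as [N HN]; exists N; intros n Hn.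
    assert (INR N <= INR (S n)) by (apply le_INR; lia).
    assert (0 < / e) by (apply Rinv_0_lt_compat; lra).
    unfold Rdist; rewrite Rminus_0_r, Rabs_pos_eq
      by (apply Rlt_le, Rinv_0_lt_compat; lra).
    rewrite <- (Rinv_inv e). apply Rinv_lt_contravar; [apply Rmult_lt_0_compat; lra | lra].
Qed.

Lemma rGamma_rec (z : Cx) : rGamma z = (z * rGamma (z + Cx1)%Cx)%Cx.
Proof.
  eapply Cseq_cv_unique; [|apply Cseq_cv_scal, rGamma_cv].
  (* At index N = [S n] the identity z r(z+1) = r(z) (1 + (z+1)/N) between terms is exact; index 0
     is skipped because [Cnatpow_1] fails there. *)
  apply Cseq_cv_S.
  apply (Cseq_cv_ext (fun n => (rGamma_seq z (S n) *
    (Cx1 + (z + Cx1) * RtoC (/ INR (S n))))%Cx)).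
  - intros n; unfold rGamma_seq.
    change (poch z (S (S n))) with (poch z (S n) * (z + RtoC (INR (S n))))%Cx.
    change (poch (z + Cx1)%Cx (S (S n))) with
      (poch (z + Cx1)%Cx (S n) * (z + Cx1 + RtoC (INR (S n))))%Cx.
    pose proof (poch_succ_l z (S n)) as E.
    change (poch z (S (S n))) with (poch z (S n) * (z + RtoC (INR (S n))))%Cx in E.
    rewrite E, Cnatpow_add, Cnatpow_1, RtoC_inv by lia.
    pose proof (RtoC_S_neq0 n). pose proof (RtoC_fact_neq0 (S n)).
    pose proof (Cnatpow_neq0 (S n) z). field; auto.
  - replace (rGamma z) with (rGamma z * (Cx1 + (z + Cx1) * Cx0))%Cx by ring.
    apply Cseq_cv_mul; [apply (Cseq_cv_S (rGamma_seq z)), rGamma_cv|].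
    apply Cseq_cv_add; [apply Cseq_cv_const|].
    apply Cseq_cv_scal, cv_inv_INR_S.
Qed.

(** * Gauss' sum *)

Lemma Csum_ext (f g : nat -> Cx) (n : nat) : (forall k, f k = g k) -> Csum f n = Csum g n.
Proof. intros H; induction n; simpl; rewrite ?IHn, H; reflexivity. Qed.
Lemma Csum_add (f g : nat -> Cx) (n : nat) :
  Csum (fun k => f k + g k)%Cx n = (Csum f n + Csum g n)%Cx.
Proof. induction n; simpl; [reflexivity | rewrite IHn; ring]. Qed.
Lemma Csum_scal (z : Cx) (f : nat -> Cx) (n : nat) :
  Csum (fun k => z * f k)%Cx n = (z * Csum f n)%Cx.
Proof. induction n; simpl; [reflexivity | rewrite IHn; ring]. Qed.
Lemma Csum_sub (f g : nat -> Cx) (n : nat) :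
  Csum (fun k => f k - g k)%Cx n = (Csum f n - Csum g n)%Cx.
Proof. induction n; simpl; [reflexivity | rewrite IHn; ring]. Qed.
Lemma Cnorm_Csum_telescope (f : nat -> Cx) (e : nat -> R) (n : nat) :
  (forall k, Cnorm (f k) <= e k - e (S k)) -> Cnorm (Csum f n) <= e O - e (S n).
Proof.
  intros H; induction n as [|n IH]; simpl; [apply H|].
  eapply Rle_trans; [apply Cnorm_add|]; specialize (H (S n)); lra.
Qed.

(** * Power bounds and the coefficients (v)_n / n! *)

Lemma Rpower_neg_cv0 (e : R) : 0 < e -> Un_cv (fun n => Rpower (INR (S n)) (- e)) 0.
Proof.
  intros He d Hd.
  destruct (INR_unbounded (exp (- ln d / e))) as [N HN]; exists N; intros n Hn.
  assert (INR N <= INR (S n)) by (apply le_INR; lia).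
  unfold Rdist; rewrite Rminus_0_r; unfold Rpower.
  rewrite Rabs_pos_eq by apply Rlt_le, exp_pos.
  rewrite <- (exp_ln d) at 1 by lra. apply exp_increasing.
  assert (- ln d / e < ln (INR (S n))).
  { apply exp_lt_inv. rewrite exp_ln; [lra|]. apply lt_0_INR; lia. }
  apply (Rmult_lt_compat_l e) in H0; [|lra].
  replace (e * (- ln d / e)) with (- ln d) in H0 by (field; lra). lra.
Qed.
Lemma Rinv_Rpower (x : R) : 0 < x -> / x = Rpower x (-1).
Proof.
  intros H; replace (-1) with (- (1)) by ring; rewrite Rpower_Ropp, Rpower_1; auto.
Qed.
(** Substitute for the integral test. From exp t >= 1 + t with t = e (ln(x+1) - ln x) >= e/(x+1),
    the difference on the right is at least e (x+1)^(-1-e); then x + 1 <= 2x explains the constant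
    2^(1+e) / e. *)
Lemma Rpower_p_series_telescope (e : R) : 0 < e -> exists K, 0 < K /\ forall x, 1 <= x ->
  Rpower x (-1 - e) <= K * (Rpower x (- e) - Rpower (x + 1) (- e)).
Proof.
  intros He; exists (Rpower 2 (1 + e) / e).
  assert (P : forall x y, 0 < Rpower x y) by (intros; apply exp_pos).
  split; [apply Rdiv_lt_0_compat; auto|]. intros x Hx.
  assert (H1 : Rpower (x + 1) (- e) * (e * / (x + 1)) <= Rpower x (- e) - Rpower (x + 1) (- e)).
  { replace (Rpower x (- e)) with (Rpower (x + 1) (- e) * exp (e * (ln (x + 1) - ln x)))
      by (unfold Rpower; rewrite <- exp_plus; f_equal; ring).
    pose proof (exp_ineq1_le (e * (ln (x + 1) - ln x))).
    destruct (ln_succ_bounds x) as [L _]; [lra|].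
    specialize (P (x + 1) (- e)).
    assert (e * / (x + 1) <= e * (ln (x + 1) - ln x)) by (apply Rmult_le_compat_l; lra).
    nra. }
  apply Rle_trans with (Rpower 2 (1 + e) / e * (Rpower (x + 1) (- e) * (e * / (x + 1)))).
  2: { apply Rmult_le_compat_l; auto. apply Rlt_le, Rdiv_lt_0_compat; auto. }
  replace (Rpower 2 (1 + e) / e * (Rpower (x + 1) (- e) * (e * / (x + 1))))
    with (Rpower 2 (1 + e) * (Rpower (x + 1) (- e) * / (x + 1))) by (field; lra).
  rewrite (Rinv_Rpower (x + 1)) by lra.
  rewrite <- Rpower_plus.
  replace (- e + -1) with (- (1 + e)) by ring. replace (-1 - e) with (- (1 + e)) by ring.
  rewrite !Rpower_Ropp.
  apply Rmult_le_reg_l with (Rpower x (1 + e)); [auto|].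
  rewrite Rinv_r by (apply Rgt_not_eq, P).
  rewrite <- Rmult_assoc, Rpower_mult_distr by lra.
  apply Rmult_le_reg_r with (Rpower (x + 1) (1 + e)); [auto|].
  rewrite Rmult_1_l, Rmult_assoc, Rinv_l, Rmult_1_r by (apply Rgt_not_eq, P).
  apply Rle_Rpower_l; lra.
Qed.

(** Coefficient of x^n in the power series of (1 - x)^(-v). *)
Definition rising_coef (v : Cx) (n : nat) : Cx := (poch v n / RtoC (INR (fact n)))%Cx.

Lemma rising_coef_S (v : Cx) (n : nat) :
  rising_coef v (S n) = (rising_coef v n * (v + RtoC (INR n)) / RtoC (INR (S n)))%Cx.
Proof.
  unfold rising_coef. replace (fact (S n)) with (S n * fact n)%nat by reflexivity.
  rewrite mult_INR, RtoC_mul. pose proof (RtoC_S_neq0 n). pose proof (RtoC_fact_neq0 n).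
  simpl poch; field; auto.
Qed.
(** Multiplication of the generating function (1 - x)^(-v) by 1 - x. *)
Lemma rising_coef_pred (v : Cx) (n : nat) :
  rising_coef (v - Cx1)%Cx (S n) = (rising_coef v (S n) - rising_coef v n)%Cx.
Proof.
  unfold rising_coef. rewrite poch_succ_l.
  replace (v - Cx1 + Cx1)%Cx with v by ring.
  replace (fact (S n)) with (S n * fact n)%nat by reflexivity.
  rewrite mult_INR, RtoC_mul. pose proof (RtoC_S_neq0 n). pose proof (RtoC_fact_neq0 n).
  simpl poch; rewrite RtoC_S in *; field; auto.
Qed.

(** Consecutive coefficients have ratio 1 + (v-1)/(n+1). Division by (n+1)^(v-1) therefore leaves a
    convergent, hence bounded, infinite product; the base n + 1 covers n = 0 too. *)
Lemma rising_coef_bound (v : Cx) : exists B, 0 < B /\ forall n,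
  Cnorm (rising_coef v n) <= B * Rpower (INR (S n)) (Re v - 1).
Proof.
  set (z := (v - Cx1)%Cx).
  set (u := fun n => (rising_coef v n * Cexp (- (z * RtoC (ln (INR (S n)))))%Cx)%Cx).
  destruct (gauss_factor_bound z) as [C [HC [N HN]]].
  destruct (Cseq_cv_infinite_product u
    (fun n => ((Cx1 + z * RtoC (/ INR (S n))) *
      Cexp (- (z * RtoC (ln (INR (S (S n))) - ln (INR (S n)))))%Cx)%Cx) C N HC) as [l Hl].
  - intros n _; unfold u.
    rewrite rising_coef_S.
    replace (Cexp (- (z * RtoC (ln (INR (S (S n))))))%Cx) with
     (Cexp (- (z * RtoC (ln (INR (S n)))))%Cx *
      Cexp (- (z * RtoC (ln (INR (S (S n))) - ln (INR (S n)))))%Cx)%Cx.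
    2: { rewrite <- Cexp_add; f_equal; unfold Rminus; rewrite RtoC_add, RtoC_opp; ring. }
    rewrite RtoC_inv. pose proof (RtoC_S_neq0 n) as Q.
    rewrite RtoC_S in *.
    generalize (Cexp (- (z * RtoC (ln (INR (S n)))))%Cx)
      (Cexp (- (z * RtoC (ln (INR (S (S n))) - ln (INR (S n)))))%Cx).
    intros E1 E2; unfold z; field; auto.
  - intros n Hn; apply HN; [lia|]; apply ln_step_bound_succ.
  - destruct (Cseq_cv_bounded _ _ Hl) as [B [HB H]]; exists B; split; [exact HB|].
    intros n; specialize (H n); unfold u in H.
    rewrite Cnorm_mul, Cnorm_Cexp in H.
    pose proof (exp_pos (Re v - 1)).
    replace (Cnorm (rising_coef v n)) with (Cnorm (rising_coef v n) *
      exp (Re (- (z * RtoC (ln (INR (S n)))))%Cx) * Rpower (INR (S n)) (Re v - 1)).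
    + apply Rmult_le_compat_r; [apply Rlt_le, exp_pos | exact H].
    + unfold Rpower; rewrite Rmult_assoc, <- exp_plus.
      match goal with |- _ * exp ?t = _ => replace t with 0 end.
      * rewrite exp_0; ring.
      * unfold z; simpl; ring.
Qed.
Lemma rising_coef_cv0 (v : Cx) : Re v < 1 -> Cseq_cv (rising_coef v) Cx0.
Proof.
  intros Hv; destruct (rising_coef_bound v) as [B [HB H]].
  apply (Cseq_cv_squeeze _ _ (fun n => B * Rpower (INR (S n)) (- (1 - Re v))) 0).
  - intros n _. replace (rising_coef v n - Cx0)%Cx with (rising_coef v n) by ring.
    replace (- (1 - Re v)) with (Re v - 1) by ring; apply H.
  - rewrite <- (Rmult_0_r B). apply CV_mult; [|apply Rpower_neg_cv0; lra].
    intros e He; exists O; intros; rewrite Rdist_eq; lra.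
Qed.

(** These are partial sums of 2F1(v, s; s+1; 1) / s, which for Re s > 0 is the Beta integral of
    t^(s-1) (1-t)^(-v) expanded termwise. *)
Definition gauss_psum (v s : Cx) : nat -> Cx :=
  Csum (fun n => rising_coef v n / (s + RtoC (INR n)))%Cx.
Definition gauss_sum (v s : Cx) : Cx := Clim (gauss_psum v s).

Lemma gauss_psum_S (v s : Cx) (n : nat) : gauss_psum v s (S n) =
  (gauss_psum v s n + rising_coef v (S n) / (s + RtoC (INR (S n))))%Cx.
Proof. reflexivity. Qed.
Lemma rising_coef_0 (v : Cx) : rising_coef v 0 = Cx1.
Proof. unfold rising_coef; simpl; change (RtoC 1) with Cx1; field; apply Cx1_neq0. Qed.

Lemma Cnorm_add_INR_ge (s : Cx) (x : R) : 2 * Cnorm s <= x -> x / 2 <= Cnorm (s + RtoC x)%Cx.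
Proof.
  intros H. pose proof (Cnorm_ge0 s).
  pose proof (Cnorm_sub_ge (RtoC x) (- s)%Cx) as K.
  rewrite Cnorm_opp, Cnorm_RtoC, Rabs_pos_eq in K by lra.
  replace (RtoC x - - s)%Cx with (s + RtoC x)%Cx in K by ring. lra.
Qed.

Lemma gauss_psum_cv (v s : Cx) : Re v < 1 -> Cseq_cv (gauss_psum v s) (gauss_sum v s).
Proof.
  intros Hv; destruct (rising_coef_bound v) as [B [HB H]].
  destruct (Rpower_p_series_telescope (1 - Re v)) as [K [HK Ht]]; [lra|].
  destruct (INR_unbounded (2 * Cnorm s)) as [N HN].
  assert (P : forall x y, 0 < Rpower x y) by (intros; apply exp_pos).
  destruct (Cseq_cv_telescoping_bound (gauss_psum v s)
    (fun n => 4 * B * K * Rpower (INR (S (S n))) (- (1 - Re v))) (S N)) as [l Hl].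
  - intros n _. specialize (P (INR (S (S n))) (- (1 - Re v))). apply Rmult_le_pos; [nra | lra].
  - intros n Hn; rewrite gauss_psum_S.
    match goal with |- Cnorm ?t <= _ => replace t with
      (rising_coef v (S n) / (s + RtoC (INR (S n))))%Cx by ring end.
    assert (Hx : INR N <= INR (S n)) by (apply le_INR; lia).
    assert (H1 : 1 <= INR (S n)) by (apply (le_INR 1); lia).
    assert (H2 : INR (S n) / 2 <= Cnorm (s + RtoC (INR (S n)))%Cx)
      by (apply Cnorm_add_INR_ge; lra).
    specialize (H (S n)). specialize (Ht (INR (S (S n)))).
    rewrite <- (S_INR (S (S n))) in Ht.
    unfold Cdiv; rewrite Cnorm_mul, Cnorm_inv by (intros E; rewrite E, Cnorm_0 in H2; lra).
    set (x := INR (S (S n))) in *.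
    assert (Hxx : x = INR (S n) + 1) by (unfold x; rewrite (S_INR (S n)); ring).
    (* Here [x] is n + 2, whereas the denominator is at least (n+1)/2; hence the factor 4 instead of
       2. *)
    apply Rle_trans with (B * Rpower x (Re v - 1) * (4 * / x)).
    + apply Rmult_le_compat; auto using Cnorm_ge0.
      * apply Rlt_le, Rinv_0_lt_compat; lra.
      * replace (4 * / x) with (/ (x / 4)) by (field; lra).
        apply Rinv_le_contravar; lra.
    + rewrite Rinv_Rpower by lra.
      replace (B * Rpower x (Re v - 1) * (4 * Rpower x (-1))) with
        (4 * B * (Rpower x (Re v - 1) * Rpower x (-1))) by ring.
      rewrite <- Rpower_plus.
      replace (Re v - 1 + -1) with (-1 - (1 - Re v)) by ring.
      specialize (Ht ltac:(lra)).
      rewrite (S_INR (S (S n))). fold x. rewrite (S_INR (S (S n))) in Ht; fold x in Ht. nra.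
  - unfold gauss_sum; rewrite (Clim_eq _ _ Hl); exact Hl.
Qed.

(** Finite form of the Beta recursion s B(s, b) = (s + b) B(s+1, b) with b = 1 - v; truncation
    leaves the boundary term [rising_coef v (S n)], which tends to 0 when Re v < 1. *)
Lemma gauss_psum_shift (v s : Cx) (n : nat) : ~ in_Zle0 s ->
  (s * gauss_psum v s (S n))%Cx =
  (rising_coef v (S n) + (Cx1 + s - v) * gauss_psum v (s + Cx1)%Cx n)%Cx.
Proof.
  intros Hs; induction n as [|n IH].
  - rewrite gauss_psum_S, rising_coef_S; unfold gauss_psum; simpl Csum.
    rewrite rising_coef_0. change (RtoC (INR 0)) with Cx0; change (RtoC 0) with Cx0;
      change (RtoC (INR 1)) with Cx1.
    pose proof (not_in_Zle0_add s 0 Hs) as H0; pose proof (not_in_Zle0_add s 1 Hs) as H1.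
    change (RtoC (INR 0)) with Cx0 in H0; change (RtoC (INR 1)) with Cx1 in H1.
    field. repeat split; auto using Cx1_neq0.
    intros E; apply H0; rewrite E; ring.
  - rewrite gauss_psum_S.
    replace (s * (gauss_psum v s (S n) + rising_coef v (S (S n)) / (s + RtoC (INR (S (S n))))))%Cx
      with (s * gauss_psum v s (S n) + s * (rising_coef v (S (S n)) / (s + RtoC (INR (S (S n))))))%Cx
      by ring.
    rewrite IH, gauss_psum_S, (rising_coef_S v (S n)).
    pose proof (RtoC_S_neq0 (S n)) as H0. pose proof (not_in_Zle0_add s (S (S n)) Hs) as H1.
    rewrite (RtoC_S (S n)) in *.
    field; repeat split; auto; intros E; apply H1; rewrite <- E; cx.
Qed.
Lemma gauss_sum_shift (v s : Cx) : Re v < 1 -> ~ in_Zle0 s ->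
  (s * gauss_sum v s)%Cx = ((Cx1 + s - v) * gauss_sum v (s + Cx1)%Cx)%Cx.
Proof.
  intros Hv Hs.
  apply (Cseq_cv_unique (fun n => s * gauss_psum v s (S n))%Cx).
  - apply Cseq_cv_scal, (Cseq_cv_S (gauss_psum v s)), gauss_psum_cv, Hv.
  - eapply Cseq_cv_ext; [intros n; symmetry; apply gauss_psum_shift, Hs|].
    replace ((Cx1 + s - v) * gauss_sum v (s + Cx1)%Cx)%Cx with
      (Cx0 + (Cx1 + s - v) * gauss_sum v (s + Cx1)%Cx)%Cx by ring.
    apply Cseq_cv_add.
    + apply (Cseq_cv_S (rising_coef v)), rising_coef_cv0, Hv.
    + apply Cseq_cv_scal, gauss_psum_cv, Hv.
Qed.
Lemma gauss_sum_shift_iter (v s : Cx) (m : nat) : Re v < 1 -> ~ in_Zle0 s ->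
  (poch s m * gauss_sum v s)%Cx =
  (poch (Cx1 + s - v)%Cx m * gauss_sum v (s + RtoC (INR m))%Cx)%Cx.
Proof.
  intros Hv Hs; induction m as [|m IH].
  - replace (s + RtoC (INR 0))%Cx with s by cx. reflexivity.
  - simpl poch.
    assert (Hsm : ~ in_Zle0 (s + RtoC (INR m))%Cx).
    { clear IH; induction m as [|m IH].
      - replace (s + RtoC (INR 0))%Cx with s by cx; auto.
      - rewrite RtoC_S.
        replace (s + (RtoC (INR m) + Cx1))%Cx with (s + RtoC (INR m) + Cx1)%Cx by ring.
        apply not_in_Zle0_succ, IH. }
    pose proof (gauss_sum_shift v _ Hv Hsm) as E.
    rewrite RtoC_S.
    replace (s + (RtoC (INR m) + Cx1))%Cx with (s + RtoC (INR m) + Cx1)%Cx by ring.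
    replace (Cx1 + s - v + RtoC (INR m))%Cx with (Cx1 + (s + RtoC (INR m)) - v)%Cx by ring.
    transitivity (poch s m * gauss_sum v s * (s + RtoC (INR m)))%Cx; [ring|].
    rewrite IH.
    transitivity (poch (Cx1 + s - v)%Cx m *
      ((s + RtoC (INR m)) * gauss_sum v (s + RtoC (INR m))%Cx))%Cx; [ring|].
    rewrite E; ring.
Qed.

(** Telescoping: (1 - v)/(n+1) times [rising_coef v n] equals
    [rising_coef v n - rising_coef v (S n)]. *)
Lemma gauss_psum_1 (v : Cx) (n : nat) :
  ((Cx1 - v) * gauss_psum v Cx1 n)%Cx = (Cx1 - rising_coef v (S n))%Cx.
Proof.
  induction n as [|n IH].
  - rewrite rising_coef_S; unfold gauss_psum; simpl Csum.
    rewrite rising_coef_0. change (RtoC (INR 0)) with Cx0; change (RtoC 0) with Cx0;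
      change (RtoC (INR 1)) with Cx1.
    field. repeat split; auto using Cx1_neq0.
  - rewrite gauss_psum_S.
    replace ((Cx1 - v) * (gauss_psum v Cx1 n + rising_coef v (S n) / (Cx1 + RtoC (INR (S n)))))%Cx
      with ((Cx1 - v) * gauss_psum v Cx1 n +
            (Cx1 - v) * (rising_coef v (S n) / (Cx1 + RtoC (INR (S n)))))%Cx by ring.
    rewrite IH, (rising_coef_S v (S n)).
    pose proof (RtoC_S_neq0 (S n)) as H0. rewrite (RtoC_S (S n)) in *.
    field; repeat split; auto; intros E; apply H0; rewrite <- E; cx.
Qed.
Lemma gauss_sum_1 (v : Cx) : Re v < 1 -> ((Cx1 - v) * gauss_sum v Cx1)%Cx = Cx1.
Proof.
  intros Hv; eapply Cseq_cv_unique; [apply Cseq_cv_scal, gauss_psum_cv, Hv|].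
  eapply Cseq_cv_ext; [intros n; symmetry; apply gauss_psum_1|].
  assert (E : (Cx1 - Cx0)%Cx = Cx1) by ring.
  refine (eq_ind _ (Cseq_cv _) _ _ E).
  apply Cseq_cv_sub; [apply Cseq_cv_const|].
  apply (Cseq_cv_S (rising_coef v)), rising_coef_cv0, Hv.
Qed.
Lemma poch_1 (n : nat) : poch Cx1 n = RtoC (INR (fact n)).
Proof.
  induction n as [|n IH]; [reflexivity|].
  replace (fact (S n)) with (S n * fact n)%nat by reflexivity.
  simpl poch; rewrite IH, mult_INR, RtoC_mul, RtoC_S; ring.
Qed.
(** This supplies the comparison sequence: multiplied by m^(1-v), the value m! / (1-v)_(m+1) is
    exactly the m-th Gauss quotient of Gamma(1-v). *)
Lemma gauss_sum_nat (v : Cx) (m : nat) : Re v < 1 ->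
  (poch (Cx1 - v)%Cx (S m) * gauss_sum v (Cx1 + RtoC (INR m))%Cx)%Cx = RtoC (INR (fact m)).
Proof.
  intros Hv.
  pose proof (gauss_sum_shift_iter v Cx1 m Hv) as E.
  rewrite poch_succ_l.
  replace (Cx1 - v + Cx1)%Cx with (Cx1 + Cx1 - v)%Cx by ring.
  transitivity ((Cx1 - v) * (poch (Cx1 + Cx1 - v)%Cx m * gauss_sum v (Cx1 + RtoC (INR m))%Cx))%Cx;
    [ring|].
  rewrite <- E by (apply not_in_Zle0_Re_pos; simpl; lra).
  transitivity (poch Cx1 m * ((Cx1 - v) * gauss_sum v Cx1))%Cx; [ring|].
  rewrite gauss_sum_1, poch_1 by auto; ring.
Qed.

(** Termwise, 1/(s+q) - 1/q = -s / ((s+q) q) with q = k + 1 + m. The decay 1/q^2 has to pay both for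
    summability in k and for smallness in m. *)
Lemma gauss_sum_diff_bound (v s : Cx) : - (1 / 2) < Re v < 1 -> exists C N, 0 < C /\
  forall m, (N <= m)%nat ->
  Cnorm (gauss_sum v (s + Cx1 + RtoC (INR m))%Cx - gauss_sum v (Cx1 + RtoC (INR m))%Cx)%Cx
  <= C * Rpower (INR (S m)) (Re v - 3 / 2).
Proof.
  intros Hv; destruct (rising_coef_bound v) as [B [HB H]].
  destruct (Rpower_p_series_telescope (1 / 2)) as [K [HK Ht]]; [lra|].
  destruct (INR_unbounded (2 * Cnorm s)) as [N HN].
  assert (P : forall x y, 0 < Rpower x y) by (intros; apply exp_pos).
  pose proof (Cnorm_ge0 s) as Hs0.
  exists (2 * Cnorm s * B * K + 1), N; split.
  { assert (0 <= 2 * Cnorm s * B * K); [|lra]. repeat apply Rmult_le_pos; lra. }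
  intros m Hm.
  assert (HNm : INR N <= INR m) by (apply le_INR; lia).
  set (y := INR (S m)).
  assert (Hy : y = INR m + 1) by (unfold y; rewrite S_INR; ring).
  assert (Hm0 : 0 <= INR m) by apply pos_INR.
  set (c := 2 * Cnorm s * B * Rpower y (Re v - 3 / 2)).
  assert (Hc : 0 <= c) by (unfold c; repeat apply Rmult_le_pos; auto; try lra; apply Rlt_le, P).
  apply Rle_trans with (c * K).
  2: { unfold c. specialize (P y (Re v - 3 / 2)). nra. }
  apply (Cnorm_lim_le (fun n => gauss_psum v (s + Cx1 + RtoC (INR m))%Cx n -
                                gauss_psum v (Cx1 + RtoC (INR m))%Cx n)%Cx).
  2: { apply Cseq_cv_sub; apply gauss_psum_cv; lra. }
  intros n; unfold gauss_psum; rewrite <- Csum_sub.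
  eapply Rle_trans; [apply Cnorm_Csum_telescope with
    (e := fun k => c * K * Rpower (INR (S k)) (- (1 / 2)))|].
  2: { specialize (P (INR (S (S n))) (- (1 / 2))).
       change (INR 1) with 1; unfold Rpower at 1; rewrite ln_1, Rmult_0_r, exp_0.
       assert (0 <= c * K) by (apply Rmult_le_pos; lra). nra. }
  intros k. specialize (H k). specialize (Ht (INR (S k))).
  rewrite (S_INR (S k)). set (x := INR (S k)) in *.
  assert (Hx : 1 <= x) by (apply (le_INR 1); lia). specialize (Ht Hx).
  assert (Hxk : x = INR k + 1) by (unfold x; rewrite S_INR; ring).
  set (q := x + INR m).
  assert (Hq : q / 2 <= Cnorm (s + RtoC q)%Cx) by (apply Cnorm_add_INR_ge; unfold q; lra).
  assert (Hsq : (s + RtoC q)%Cx <> Cx0)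
    by (intros E; rewrite E, Cnorm_0 in Hq; unfold q in Hq; lra).
  assert (Hq0 : RtoC q <> Cx0) by (apply RtoC_neq0; unfold q; lra).
  replace (s + Cx1 + RtoC (INR m) + RtoC (INR k))%Cx with (s + RtoC q)%Cx
    by (unfold q; rewrite Hxk, !RtoC_add; change (RtoC 1) with Cx1; ring).
  replace (Cx1 + RtoC (INR m) + RtoC (INR k))%Cx with (RtoC q)
    by (unfold q; rewrite Hxk, !RtoC_add; change (RtoC 1) with Cx1; ring).
  replace (rising_coef v k / (s + RtoC q) - rising_coef v k / RtoC q)%Cx with
    (rising_coef v k * (- s * (Cinv (s + RtoC q)%Cx * Cinv (RtoC q))))%Cx by (field; auto).
  rewrite !Cnorm_mul, Cnorm_opp, !Cnorm_inv, Cnorm_RtoC, Rabs_pos_eq by (auto; unfold q; lra).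
  (* Split q^2 as q^(Re v + 1/2) q^(3/2 - Re v), and bound the first factor below by a power of x =
     k + 1, the second by one of y = m + 1. Both exponents are positive because -1/2 < Re v < 1; in
     x this leaves the summable x^(-3/2). *)
  assert (Hqq : / Cnorm (s + RtoC q)%Cx * / q <= 2 * (Rpower x (- (Re v + 1 / 2)) * Rpower y (Re v - 3 / 2))).
  { apply Rle_trans with (/ (q / 2) * / q).
    - apply Rmult_le_compat_r; [apply Rlt_le, Rinv_0_lt_compat; unfold q; lra|].
      apply Rinv_le_contravar; [unfold q; lra | exact Hq].
    - replace (/ (q / 2) * / q) with (2 * / (q * q)) by (field; unfold q; lra).
      apply Rmult_le_compat_l; [lra|].
      replace (Re v - 3 / 2) with (- (3 / 2 - Re v)) by ring.
      rewrite !Rpower_Ropp, <- Rinv_mult. apply Rinv_le_contravar; [apply Rmult_lt_0_compat; auto|].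
      replace (q * q) with (Rpower q (Re v + 1 / 2) * Rpower q (3 / 2 - Re v)).
      + apply Rmult_le_compat; try (apply Rlt_le, P);
          apply Rle_Rpower_l; unfold q; lra.
      + rewrite <- Rpower_plus. replace (Re v + 1 / 2 + (3 / 2 - Re v)) with (1 + 1) by field.
        rewrite Rpower_plus, Rpower_1; [ring | unfold q; lra]. }
  apply Rle_trans with (B * Rpower x (Re v - 1) *
    (Cnorm s * (2 * (Rpower x (- (Re v + 1 / 2)) * Rpower y (Re v - 3 / 2))))).
  - apply Rmult_le_compat; auto using Cnorm_ge0.
    + apply Rmult_le_pos; auto. apply Rmult_le_pos; apply Rlt_le, Rinv_0_lt_compat;
        [|unfold q; lra]. apply Cnorm_pos, Hsq.
    + apply Rmult_le_compat_l; auto.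
  - replace (B * Rpower x (Re v - 1) *
      (Cnorm s * (2 * (Rpower x (- (Re v + 1 / 2)) * Rpower y (Re v - 3 / 2))))) with
      (c * (Rpower x (Re v - 1) * Rpower x (- (Re v + 1 / 2)))) by (unfold c; ring).
    rewrite <- Rpower_plus.
    replace (Re v - 1 + - (Re v + 1 / 2)) with (-1 - 1 / 2) by field.
    replace (c * K * Rpower x (- (1 / 2)) - c * K * Rpower (x + 1) (- (1 / 2))) with
      (c * (K * (Rpower x (- (1 / 2)) - Rpower (x + 1) (- (1 / 2))))) by ring.
    apply Rmult_le_compat_l; auto.
Qed.

(** At the points 1 + n the sequence is the Gauss quotient of Gamma(1-v); passing to s + 1 + n costs
    n^(1 - Re v) n^(Re v - 3/2) = n^(-1/2), up to a constant. *)
Lemma gauss_sum_asymptotics (v s : Cx) : - (1 / 2) < Re v < 1 ->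
  Cseq_cv (fun n => Cnatpow n (Cx1 - v)%Cx * gauss_sum v (s + Cx1 + RtoC (INR n))%Cx)%Cx
    (Cinv (rGamma (Cx1 - v)%Cx)).
Proof.
  intros Hv.
  assert (Hz : ~ in_Zle0 (Cx1 - v)%Cx) by (apply not_in_Zle0_Re_pos; simpl; lra).
  pose proof (proj2 (Cinv_rGamma_seq_cv _ Hz)) as L1.
  destruct (gauss_sum_diff_bound v s Hv) as [C [N [HC H]]].
  assert (L2 : Cseq_cv (fun n => Cnatpow n (Cx1 - v)%Cx *
    (gauss_sum v (s + Cx1 + RtoC (INR n))%Cx - gauss_sum v (Cx1 + RtoC (INR n))%Cx))%Cx Cx0).
  { apply (Cseq_cv_squeeze _ _ (fun n => C * Rpower (INR (S n)) (- (1 / 2))) (S N)).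
    - intros n Hn. specialize (H n ltac:(lia)).
      match goal with |- Cnorm (?t - Cx0)%Cx <= _ =>
        replace (t - Cx0)%Cx with t by ring end.
      rewrite Cnorm_mul, Cnorm_Cnatpow.
      assert (P : forall x y, 0 < Rpower x y) by (intros; apply exp_pos).
      apply Rle_trans with (Rpower (INR (S n)) (Re (Cx1 - v)%Cx) *
        (C * Rpower (INR (S n)) (Re v - 3 / 2))).
      + apply Rmult_le_compat; auto using Cnorm_ge0; [apply Rlt_le, P|].
        apply Rle_Rpower_l; [simpl; lra|]. split; [apply lt_0_INR; lia | apply le_INR; lia].
      + right.
        replace (- (1 / 2)) with (Re (Cx1 - v)%Cx + (Re v - 3 / 2)) by (simpl; field).
        rewrite Rpower_plus; ring.
    - rewrite <- (Rmult_0_r C). apply CV_mult; [|apply Rpower_neg_cv0; lra].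
      intros e He; exists O; intros; rewrite Rdist_eq; lra. }
  replace (Cinv (rGamma (Cx1 - v)%Cx)) with (Cinv (rGamma (Cx1 - v)%Cx) + Cx0)%Cx by ring.
  eapply Cseq_cv_ext; [|exact (Cseq_cv_add _ _ _ _ L1 L2)].
  intros n; cbv beta.
  pose proof (gauss_sum_nat v n ltac:(lra)) as E.
  assert (E2 : Cinv (rGamma_seq (Cx1 - v)%Cx n) =
    (Cnatpow n (Cx1 - v)%Cx * gauss_sum v (Cx1 + RtoC (INR n))%Cx)%Cx).
  { unfold rGamma_seq; rewrite <- E.
    pose proof (poch_neq0 _ (S n) Hz). pose proof (Cnatpow_neq0 n (Cx1 - v)%Cx).
    assert (gauss_sum v (Cx1 + RtoC (INR n))%Cx <> Cx0).
    { intros E0; rewrite E0 in E. apply (RtoC_fact_neq0 n). rewrite <- E; ring. }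
    field; repeat split; auto using Cx1_neq0. }
  rewrite E2; ring.
Qed.

(** After n + 1 recursion steps, S(s) times the n-th term for 1/Gamma(s) equals the n-th term for
    1/Gamma(1+s-v) times n^(1-v) S(s+1+n). The identity is exact, and both sides converge. *)
Lemma gauss_sum_eq_strip (v s : Cx) : - (1 / 2) < Re v < 1 -> ~ in_Zle0 s ->
  (gauss_sum v s * rGamma s)%Cx = (rGamma (Cx1 + s - v)%Cx * Cinv (rGamma (Cx1 - v)%Cx))%Cx.
Proof.
  intros Hv Hs.
  eapply Cseq_cv_unique; [apply Cseq_cv_scal, rGamma_cv|].
  eapply Cseq_cv_ext; [|apply Cseq_cv_mul; [apply rGamma_cv | apply (gauss_sum_asymptotics v s Hv)]].
  intros n; cbv beta.
  pose proof (gauss_sum_shift_iter v s (S n) ltac:(lra) Hs) as E.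
  rewrite RtoC_S in E.
  replace (s + (RtoC (INR n) + Cx1))%Cx with (s + Cx1 + RtoC (INR n))%Cx in E by ring.
  unfold rGamma_seq.
  replace (Cx1 + s - v)%Cx with (s + (Cx1 - v))%Cx in * by ring.
  rewrite Cnatpow_add.
  pose proof (Cnatpow_neq0 n (Cx1 - v)%Cx). pose proof (Cnatpow_neq0 n s).
  pose proof (RtoC_fact_neq0 n).
  transitivity (poch (s + (Cx1 - v))%Cx (S n) * gauss_sum v (s + Cx1 + RtoC (INR n))%Cx /
    (RtoC (INR (fact n)) * Cnatpow n s))%Cx; [field; auto|].
  rewrite <- E; field; auto.
Qed.

(** In the Beta integral: (1-t)^(1-v) = (1-t)^(-v) - t (1-t)^(-v). *)
Lemma gauss_psum_pred (v s : Cx) (n : nat) :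
  gauss_psum (v - Cx1)%Cx s (S n) = (gauss_psum v s (S n) - gauss_psum v (s + Cx1)%Cx n)%Cx.
Proof.
  induction n as [|n IH].
  - rewrite !gauss_psum_S, rising_coef_pred; unfold gauss_psum; simpl Csum.
    rewrite !rising_coef_0. change (RtoC (INR 0)) with Cx0; change (RtoC 0) with Cx0;
      change (RtoC (INR 1)) with Cx1.
    replace (s + Cx1 + Cx0)%Cx with (s + Cx1)%Cx by ring.
    unfold Cdiv; ring.
  - rewrite !(gauss_psum_S _ _ (S n)), IH, (rising_coef_pred v (S n)), (gauss_psum_S v (s + Cx1)%Cx n).
    rewrite (RtoC_S (S n)).
    replace (s + Cx1 + RtoC (INR (S n)))%Cx with (s + (RtoC (INR (S n)) + Cx1))%Cx by ring.
    unfold Cdiv; ring.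
Qed.
Lemma gauss_sum_pred (v s : Cx) : Re v < 1 ->
  gauss_sum (v - Cx1)%Cx s = (gauss_sum v s - gauss_sum v (s + Cx1)%Cx)%Cx.
Proof.
  intros Hv. apply (Cseq_cv_unique (fun n => gauss_psum (v - Cx1)%Cx s (S n))).
  - apply (Cseq_cv_S (gauss_psum (v - Cx1)%Cx s)), gauss_psum_cv; simpl; lra.
  - eapply Cseq_cv_ext; [intros n; symmetry; apply gauss_psum_pred|].
    apply Cseq_cv_sub; [apply (Cseq_cv_S (gauss_psum v s))|]; apply gauss_psum_cv, Hv.
Qed.

Lemma gauss_sum_eq (v s : Cx) : Re v < 1 -> ~ in_Zle0 s ->
  gauss_sum v s = (rGamma (Cx1 + s - v) * Cinv (rGamma (Cx1 - v)) * Cinv (rGamma s))%Cx.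
Proof.
  intros Hv Hs.
  destruct (INR_unbounded (- Re v)) as [k Hk].
  assert (G : - INR k < Re v) by lra; clear Hk.
  revert v s Hv Hs G; induction k as [|k IH]; intros v s Hv Hs G.
  - simpl in G.
    pose proof (gauss_sum_eq_strip v s ltac:(lra) Hs) as E. pose proof (rGamma_neq0 s Hs).
    rewrite <- E; field; auto.
  - rewrite S_INR in G.
    (* If Re v >= 0 the strip formula applies directly; otherwise v + 1 still has real part below 1
       and satisfies the induction hypothesis. *)
    destruct (Rlt_dec (Re v) 0) as [Hv0|Hv0].
    2: { pose proof (gauss_sum_eq_strip v s ltac:(lra) Hs) as E. pose proof (rGamma_neq0 s Hs).
         rewrite <- E; field; auto. }
    set (w := (v + Cx1)%Cx).
    replace v with (w - Cx1)%Cx by (unfold w; ring).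
    assert (Hw : Re w < 1) by (simpl; lra).
    rewrite gauss_sum_pred by exact Hw.
    rewrite (IH w s Hw Hs) by (simpl; lra).
    rewrite (IH w (s + Cx1)%Cx Hw (not_in_Zle0_succ s Hs)) by (simpl; lra).
    replace (Cx1 + (s + Cx1) - w)%Cx with (Cx1 + s - w + Cx1)%Cx by ring.
    replace (Cx1 + s - (w - Cx1))%Cx with (Cx1 + s - w + Cx1)%Cx by ring.
    replace (Cx1 - (w - Cx1))%Cx with (Cx1 - w + Cx1)%Cx by ring.
    assert (Hz : ~ in_Zle0 (Cx1 - w)%Cx) by (apply not_in_Zle0_Re_pos; simpl in *; lra).
    (* With all arguments raised by one, the claim reduces to (1+s-w)/s - 1 = (1-w)/s, whose
       numerator cancels the factor produced by 1/Gamma(1-w). *)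
    rewrite (rGamma_rec (Cx1 + s - w)%Cx), (rGamma_rec (Cx1 - w)%Cx), (rGamma_rec s).
    pose proof (not_in_Zle0_neq0 _ Hz). pose proof (not_in_Zle0_neq0 _ Hs).
    pose proof (rGamma_neq0 _ (not_in_Zle0_succ _ Hz)).
    pose proof (rGamma_neq0 _ (not_in_Zle0_succ _ Hs)).
    field; auto.
Qed.

(** * The reflection formula *)

Definition Csin (z : Cx) : Cx :=
  ((Cexp (Ci * z)%Cx - Cexp (- (Ci * z))%Cx) / (RtoC 2 * Ci))%Cx.

Lemma Csin_components (x y : R) :
  Csin (mkC x y) = mkC (sin x * cosh y) (cos x * sinh y).
Proof.
  unfold cosh, sinh; apply Cx_ext; simpl.
  - replace (0 * x - 1 * y) with (- y) by ring. replace (- - y) with y by ring.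
    replace (0 * y + 1 * x) with x by ring. rewrite sin_neg, cos_neg. field.
  - replace (0 * x - 1 * y) with (- y) by ring. replace (- - y) with y by ring.
    replace (0 * y + 1 * x) with x by ring. rewrite sin_neg, cos_neg. field.
Qed.

(** Takes the place of integration by parts: each relation among the integrals below is certified by
    one explicit primitive [F]. *)
Lemma RInt_lincomb (f g h F : R -> R) (a b c u v : R) :
  (forall t, continuous f t) -> (forall t, continuous g t) -> (forall t, continuous h t) ->
  (forall t, is_derive F t (a * f t + b * g t + c * h t)) ->
  a * RInt f u v + b * RInt g u v + c * RInt h u v = F v - F u.
Proof.
  intros Cf Cg Ch D.
  assert (If : is_RInt f u v (RInt f u v))
    by (apply (@RInt_correct R_CompleteNormedModule), (@ex_RInt_continuous R_CompleteNormedModule); auto).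
  assert (Ig : is_RInt g u v (RInt g u v))
    by (apply (@RInt_correct R_CompleteNormedModule), (@ex_RInt_continuous R_CompleteNormedModule); auto).
  assert (Ih : is_RInt h u v (RInt h u v))
    by (apply (@RInt_correct R_CompleteNormedModule), (@ex_RInt_continuous R_CompleteNormedModule); auto).
  apply (is_RInt_scal _ _ _ a) in If. apply (is_RInt_scal _ _ _ b) in Ig.
  apply (is_RInt_scal _ _ _ c) in Ih.
  pose proof (is_RInt_plus _ _ _ _ _ _ (is_RInt_plus _ _ _ _ _ _ If Ig) Ih) as L.
  assert (D' : is_RInt (fun t => a * f t + b * g t + c * h t) u v (minus (F v) (F u))).
  { apply (is_RInt_derive (V := R_CompleteNormedModule) F (fun t => a * f t + b * g t + c * h t));
      [auto|]. intros t _.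
    apply (continuous_plus (V := R_NormedModule) (fun t => a * f t + b * g t) (fun t => c * h t)).
    - apply (continuous_plus (V := R_NormedModule) (fun t => a * f t) (fun t => b * g t)).
      + apply (continuous_scal_r (V := R_NormedModule) a f), Cf.
      + apply (continuous_scal_r (V := R_NormedModule) b g), Cg.
    - apply (continuous_scal_r (V := R_NormedModule) c h), Ch. }
  apply (is_RInt_unique (V := R_CompleteNormedModule)) in L.
  apply (is_RInt_unique (V := R_CompleteNormedModule)) in D'.
  transitivity (RInt (fun t => a * f t + b * g t + c * h t) u v); [symmetry; exact L | exact D'].
Qed.

(** Halving t brings the arguments into [0, 1], as PI <= 4; there both cosines in 2 sin(t/2)
    cos(t/2) = t cos(u) cos(t/2) are at least 1/2. The bound serves to trade t^2 for sin(t)^2. *)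
Lemma sin_ge_quarter (t : R) : 0 <= t <= PI / 2 -> t <= 4 * sin t.
Proof.
  intros Ht. pose proof PI_4 as P.
  replace t with (2 * (t / 2)) at 2 by field. rewrite sin_2a.
  destruct (sin_eq_mul_cos (t / 2)) as [u [Hu ->]].
  rewrite (Rabs_pos_eq (t / 2)) in Hu by lra.
  pose proof (one_minus_cos_bound u). pose proof (one_minus_cos_bound (t / 2)).
  apply Rabs_le_between in Hu.
  assert (1 / 2 <= cos u) by nra. assert (1 / 2 <= cos (t / 2)) by nra.
  assert (1 / 4 <= cos u * cos (t / 2)) by nra. nra.
Qed.
Lemma cosh_le_exp_Rabs (u : R) : 1 <= cosh u <= exp (Rabs u).
Proof.
  assert (E : exp u * exp (- u) = 1) by (rewrite <- exp_plus, Rplus_opp_r; apply exp_0).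
  pose proof (exp_pos u); pose proof (exp_pos (- u)).
  unfold cosh; split.
  - pose proof (Rle_0_sqr (exp u - exp (- u))) as Q; unfold Rsqr in Q. nra.
  - assert (M : forall w, w <= Rabs u -> exp w <= exp (Rabs u)).
    { intros w [Hw | ->]; [left; apply exp_increasing, Hw | right; reflexivity]. }
    pose proof (M u (Rle_abs u)). pose proof (M (- u)) as M2.
    rewrite <- (Rabs_Ropp u) in M2 at 1. specialize (M2 (Rle_abs (- u))). lra.
Qed.
Lemma Rabs_sinh_le (u : R) : Rabs (sinh u) <= Rabs u * exp (Rabs u).
Proof.
  destruct (MVT_gen sinh 0 u cosh) as [t [Ht E]].
  - intros x _; unfold sinh, cosh; auto_derive; [auto | field].
  - intros x _; apply derivable_continuous_pt, derivable_pt_sinh.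
  - rewrite sinh_0 in E. replace (sinh u) with (u * cosh t) by lra.
    assert (Rabs t <= Rabs u).
    { unfold Rmin, Rmax in Ht; destruct (Rle_dec 0 u).
      - rewrite !Rabs_pos_eq; lra.
      - rewrite !Rabs_left1; lra. }
    rewrite Rabs_mult. destruct (cosh_le_exp_Rabs t).
    apply Rmult_le_compat_l; [apply Rabs_pos|].
    rewrite Rabs_pos_eq by lra. eapply Rle_trans; [eassumption|].
    destruct H as [H | ->]; [left; apply exp_increasing, H | right; reflexivity].
Qed.

(* Real and imaginary part of cos (2 z t) (cos t)^n at z = x + i y. *)
Definition wallis_re (x y : R) (n : nat) (t : R) : R :=
  cos (2 * x * t) * cosh (2 * y * t) * cos t ^ n.
Definition wallis_im (x y : R) (n : nat) (t : R) : R :=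
  - (sin (2 * x * t) * sinh (2 * y * t)) * cos t ^ n.
Definition wallis_int (z : Cx) (n : nat) : Cx :=
  mkC (RInt (wallis_re (Re z) (Im z) n) 0 (PI / 2)) (RInt (wallis_im (Re z) (Im z) n) 0 (PI / 2)).

Lemma continuous_wallis_re (x y : R) (n : nat) (t : R) : continuous (wallis_re x y n) t.
Proof.
  apply (ex_derive_continuous (V := R_NormedModule)); unfold wallis_re, cosh; auto_derive; auto.
Qed.
Lemma continuous_wallis_im (x y : R) (n : nat) (t : R) : continuous (wallis_im x y n) t.
Proof.
  apply (ex_derive_continuous (V := R_NormedModule)); unfold wallis_im, sinh; auto_derive; auto.
Qed.
Lemma continuous_cos_pow (n : nat) (t : R) : continuous (fun t => cos t ^ n) t.
Proof.
  apply (ex_derive_continuous (V := R_NormedModule)); auto_derive; auto.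
Qed.

Lemma wallis_int_0 (z : Cx) : (RtoC 2 * z * wallis_int z 0)%Cx = Csin (z * CPI)%Cx.
Proof.
  destruct z as [x y].
  replace (mkC x y * CPI)%Cx with (mkC (2 * x * (PI / 2)) (2 * y * (PI / 2)))
    by (apply Cx_ext; simpl; field).
  rewrite Csin_components. unfold wallis_int; apply Cx_ext; simpl.
  - transitivity (2 * x * RInt (wallis_re x y 0) 0 (PI / 2)
      + (- (2 * y)) * RInt (wallis_im x y 0) 0 (PI / 2) + 0 * RInt (wallis_re x y 0) 0 (PI / 2)).
    { ring. }
    rewrite (RInt_lincomb _ _ _ (fun t => sin (2 * x * t) * cosh (2 * y * t)));
      auto using continuous_wallis_re, continuous_wallis_im.
    + rewrite !Rmult_0_r, sin_0; ring.
    + intros t; unfold wallis_re, wallis_im, cosh, sinh; auto_derive; [auto | simpl; field].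
  - transitivity (2 * y * RInt (wallis_re x y 0) 0 (PI / 2)
      + 2 * x * RInt (wallis_im x y 0) 0 (PI / 2) + 0 * RInt (wallis_re x y 0) 0 (PI / 2)).
    { ring. }
    rewrite (RInt_lincomb _ _ _ (fun t => cos (2 * x * t) * sinh (2 * y * t)));
      auto using continuous_wallis_re, continuous_wallis_im.
    + rewrite !Rmult_0_r, sinh_0; ring.
    + intros t; unfold wallis_re, wallis_im, cosh, sinh; auto_derive; [auto | simpl; field].
Qed.

(** With N = n + 2, the primitives are the real and imaginary part of N cos(2zt) cos(t)^(N-1) sin t
    - 2z sin(2zt) cos(t)^N. The mixed terms of the derivative cancel, and the boundary values vanish
    at 0 and PI/2. *)
Lemma wallis_int_rec (z : Cx) (n : nat) :
  ((RtoC (INR (S (S n))) * RtoC (INR (S (S n))) - RtoC 4 * (z * z)) * wallis_int z (S (S n)))%Cx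
  = (RtoC (INR (S (S n)) * INR (S n)) * wallis_int z n)%Cx.
Proof.
  destruct z as [x y]. set (N := INR (S (S n))).
  assert (HN : INR (S n) = N - 1) by (unfold N; rewrite (S_INR (S n)); ring).
  assert (Hn : INR n = N - 2) by (unfold N; rewrite !S_INR; ring).
  rewrite HN. unfold wallis_int; apply Cx_ext; simpl Re; simpl Im; apply Rminus_diag_uniq.
  - transitivity ((N * N - 4 * (x * x - y * y)) * RInt (wallis_re x y (S (S n))) 0 (PI / 2)
      + 8 * x * y * RInt (wallis_im x y (S (S n))) 0 (PI / 2)
      + (- (N * (N - 1))) * RInt (wallis_re x y n) 0 (PI / 2)).
    { ring. }
    rewrite (RInt_lincomb _ _ _ (fun t =>
      N * (cos (2 * x * t) * cosh (2 * y * t)) * cos t ^ S n * sin t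
      - 2 * (x * (sin (2 * x * t) * cosh (2 * y * t)) - y * (cos (2 * x * t) * sinh (2 * y * t)))
        * cos t ^ S (S n)));
      auto using continuous_wallis_re, continuous_wallis_im.
    + rewrite !Rmult_0_r, sin_0, sinh_0, cos_PI2; simpl; ring.
    + intros t; unfold wallis_re, wallis_im, cosh, sinh; auto_derive; [auto|].
      change (Init.Nat.pred (S (S n))) with (S n). change (Init.Nat.pred (S n)) with n.
      change (match n with 0%nat => 1 | S _ => INR n + 1 end) with (INR (S n)).
      change (INR (S n) + 1) with (INR (S (S n))).
      fold N. rewrite ?HN, ?Hn.
      simpl pow. generalize (cos t ^ n); intros p.
      assert (E : sin t * sin t = 1 - cos t * cos t)
        by (pose proof (sin2_cos2 t) as Q; unfold Rsqr in Q; lra).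
      field [E].
  - transitivity ((N * N - 4 * (x * x - y * y)) * RInt (wallis_im x y (S (S n))) 0 (PI / 2)
      + (- (8 * x * y)) * RInt (wallis_re x y (S (S n))) 0 (PI / 2)
      + (- (N * (N - 1))) * RInt (wallis_im x y n) 0 (PI / 2)).
    { ring. }
    rewrite (RInt_lincomb _ _ _ (fun t =>
      - (N * (sin (2 * x * t) * sinh (2 * y * t)) * cos t ^ S n * sin t)
      - 2 * (x * (cos (2 * x * t) * sinh (2 * y * t)) + y * (sin (2 * x * t) * cosh (2 * y * t)))
        * cos t ^ S (S n)));
      auto using continuous_wallis_re, continuous_wallis_im.
    + rewrite !Rmult_0_r, sin_0, sinh_0, cos_PI2; simpl; ring.
    + intros t; unfold wallis_re, wallis_im, cosh, sinh; auto_derive; [auto|].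
      change (Init.Nat.pred (S (S n))) with (S n). change (Init.Nat.pred (S n)) with n.
      change (match n with 0%nat => 1 | S _ => INR n + 1 end) with (INR (S n)).
      change (INR (S n) + 1) with (INR (S (S n))).
      fold N. rewrite ?HN, ?Hn.
      simpl pow. generalize (cos t ^ n); intros p.
      assert (E : sin t * sin t = 1 - cos t * cos t)
        by (pose proof (sin2_cos2 t) as Q; unfold Rsqr in Q; lra).
      field [E].
Qed.

Definition wallis (n : nat) : R := RInt (fun t => cos t ^ n) 0 (PI / 2).

Lemma wallis_0 : wallis 0 = PI / 2.
Proof.
  unfold wallis; simpl. rewrite (RInt_const (V := R_CompleteNormedModule)).
  change (scal (PI / 2 - 0) 1) with ((PI / 2 - 0) * 1); ring.
Qed.
Lemma wallis_rec (n : nat) : INR (S (S n)) * wallis (S (S n)) = INR (S n) * wallis n.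
Proof.
  apply Rminus_diag_uniq.
  transitivity (INR (S (S n)) * RInt (fun t => cos t ^ S (S n)) 0 (PI / 2)
    + (- INR (S n)) * RInt (fun t => cos t ^ n) 0 (PI / 2)
    + 0 * RInt (fun t => cos t ^ n) 0 (PI / 2)).
  { unfold wallis; ring. }
  rewrite (RInt_lincomb _ _ _ (fun t => cos t ^ S n * sin t)); auto using continuous_cos_pow.
  - rewrite sin_0, cos_PI2; simpl; ring.
  - intros t; auto_derive; [auto|].
    change (Init.Nat.pred (S n)) with n.
    change (match n with 0%nat => 1 | S _ => INR n + 1 end) with (INR (S n)).
    rewrite (S_INR (S n)). simpl pow. generalize (cos t ^ n); intros p.
    assert (E : sin t * sin t = 1 - cos t * cos t)
      by (pose proof (sin2_cos2 t) as Q; unfold Rsqr in Q; lra).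
    field [E].
Qed.
Lemma wallis_even_pos (k : nat) : 0 < wallis (2 * k).
Proof.
  induction k as [|k IH].
  - rewrite Nat.mul_0_r, wallis_0; pose proof PI_RGT_0; lra.
  - replace (2 * S k)%nat with (S (S (2 * k))) by lia.
    pose proof (wallis_rec (2 * k)).
    assert (0 < INR (S (2 * k))) by (apply lt_0_INR; lia).
    assert (0 < INR (S (S (2 * k)))) by (apply lt_0_INR; lia).
    apply Rmult_lt_reg_l with (INR (S (S (2 * k)))); auto. nra.
Qed.

(** As sin^2 cos^n = cos^n - cos^(n+2), a factor sin^2 in the integrand gains 1/(n+2) relative to
    [wallis n]. *)
Lemma Rabs_RInt_cos_pow_le (f : R -> R) (C : R) (n : nat) :
  (forall t, continuous f t) ->
  (forall t, 0 <= t <= PI / 2 -> Rabs (f t) <= C * (sin t * sin t) * cos t ^ n) ->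
  Rabs (RInt f 0 (PI / 2)) <= C * (wallis n - wallis (S (S n))).
Proof.
  intros Cf Hf. pose proof PI_RGT_0.
  apply (norm_RInt_le (V := R_NormedModule) f
    (fun t => minus (scal C (cos t ^ n)) (scal C (cos t ^ S (S n)))) 0 (PI / 2)); [lra| | |].
  - intros t Ht. eapply Rle_trans; [apply Hf, Ht|]. right.
    change (C * (sin t * sin t) * cos t ^ n = C * cos t ^ n - C * cos t ^ S (S n)).
    pose proof (sin2_cos2 t) as Q; unfold Rsqr in Q.
    replace (sin t * sin t) with (1 - cos t * cos t) by lra. simpl; ring.
  - apply (@RInt_correct R_CompleteNormedModule),
      (@ex_RInt_continuous R_CompleteNormedModule); auto.
  - replace (C * (wallis n - wallis (S (S n)))) with
      (minus (scal C (wallis n)) (scal C (wallis (S (S n)))))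
      by (change (C * wallis n - C * wallis (S (S n)) = C * (wallis n - wallis (S (S n)))); ring).
    apply (is_RInt_minus (V := R_NormedModule)); apply (is_RInt_scal (V := R_NormedModule));
      apply (@RInt_correct R_CompleteNormedModule),
        (@ex_RInt_continuous R_CompleteNormedModule); auto using continuous_cos_pow.
Qed.

(** cos(2zt) = 1 + O(t^2) uniformly on [0, PI/2]: cosh - 1 is twice the square of sinh at half the
    argument, and the imaginary part is a product of two factors O(t). Then t^2 <= 16 sin(t)^2. *)
Lemma wallis_integrand_bound (x y : R) : exists C, 0 <= C /\ forall n t, 0 <= t <= PI / 2 ->
  Rabs (wallis_re x y n t - cos t ^ n) <= C * (sin t * sin t) * cos t ^ n /\
  Rabs (wallis_im x y n t) <= C * (sin t * sin t) * cos t ^ n.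
Proof.
  (* Since t <= PI/2 <= 2, the arguments y t and 2 y t stay below 4 |y| in absolute value. *)
  set (M := exp (4 * Rabs y)).
  assert (HM : 0 < M) by apply exp_pos.
  pose proof (Rabs_pos x); pose proof (Rabs_pos y).
  exists (16 * (2 * (Rabs y * Rabs y) * (M * M) + 2 * (Rabs x * Rabs x)
                 + 4 * (Rabs x * Rabs y) * M)).
  split.
  { apply Rmult_le_pos; [lra|].
    repeat apply Rplus_le_le_0_compat; repeat apply Rmult_le_pos; lra. }
  intros n t Ht.
  assert (Hc : 0 <= cos t ^ n) by (apply pow_le, cos_ge_0; pose proof PI_RGT_0; lra).
  pose proof (sin_ge_quarter t Ht) as Hs. pose proof PI_4.
  assert (Ht2 : t * t <= 16 * (sin t * sin t)) by nra.
  assert (HS : Rabs (sinh (2 * y * t)) <= 2 * Rabs y * t * M /\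
               Rabs (sinh (y * t)) <= Rabs y * t * M).
  { assert (E : forall u, Rabs u <= 4 * Rabs y -> Rabs (sinh u) <= Rabs u * M).
    { intros u Hu. eapply Rle_trans; [apply Rabs_sinh_le|].
      apply Rmult_le_compat_l; [apply Rabs_pos|].
      destruct Hu as [Hu | Hu]; [left; apply exp_increasing, Hu | right; unfold M; rewrite Hu; auto]. }
    assert (A1 : Rabs (2 * y * t) = 2 * Rabs y * t)
      by (rewrite !Rabs_mult, (Rabs_pos_eq 2), (Rabs_pos_eq t) by lra; ring).
    assert (A2 : Rabs (y * t) = Rabs y * t)
      by (rewrite !Rabs_mult, (Rabs_pos_eq t) by lra; ring).
    split; [rewrite <- A1 | rewrite <- A2]; apply E; [rewrite A1 | rewrite A2]; nra. }
  destruct HS as [S1 S2].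
  assert (HX : 0 <= 1 - cos (2 * x * t) <= 2 * (Rabs x * Rabs x) * (t * t)).
  { rewrite Rabs_sqr. pose proof (one_minus_cos_bound (2 * x * t)). nra. }
  assert (HY : 0 <= cosh (2 * y * t) - 1 <= 2 * (Rabs y * Rabs y) * (M * M) * (t * t)).
  { split; [pose proof (cosh_le_exp_Rabs (2 * y * t)); lra|].
    assert (E : cosh (2 * y * t) - 1 = 2 * (Rabs (sinh (y * t)) * Rabs (sinh (y * t)))).
    { rewrite Rabs_sqr. unfold cosh, sinh.
      replace (2 * y * t) with (y * t + y * t) by ring.
      rewrite Ropp_plus_distr, !exp_plus.
      assert (E : exp (y * t) * exp (- (y * t)) = 1)
        by (rewrite <- exp_plus, Rplus_opp_r; apply exp_0).
      field [E]. }
    rewrite E. pose proof (Rabs_pos (sinh (y * t))).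
    assert (Rabs (sinh (y * t)) * Rabs (sinh (y * t)) <= (Rabs y * t * M) * (Rabs y * t * M))
      by (apply Rmult_le_compat; lra). nra. }
  set (a := Rabs x * Rabs x) in *. set (b := Rabs y * Rabs y * (M * M)) in *.
  set (d := Rabs x * Rabs y * M).
  assert (Ha : 0 <= a) by (unfold a; nra).
  assert (Hb : 0 <= b) by (unfold b; repeat apply Rmult_le_pos; lra).
  assert (Hd : 0 <= d) by (unfold d; repeat apply Rmult_le_pos; lra).
  assert (Htt : 0 <= t * t) by nra.
  replace (16 * (2 * (Rabs y * Rabs y) * (M * M) + 2 * a + 4 * (Rabs x * Rabs y) * M))
    with (16 * (2 * b + 2 * a + 4 * d)) by (unfold a, b, d; ring).
  replace (2 * (Rabs y * Rabs y) * (M * M) * (t * t)) with (2 * b * (t * t)) in HY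
    by (unfold b; ring).
  unfold wallis_re, wallis_im; split.
  - replace (cos (2 * x * t) * cosh (2 * y * t) * cos t ^ n - cos t ^ n)
      with ((cos (2 * x * t) * (cosh (2 * y * t) - 1) - (1 - cos (2 * x * t))) * cos t ^ n) by ring.
    rewrite Rabs_mult, (Rabs_pos_eq (cos t ^ n)) by auto.
    apply Rmult_le_compat_r; auto.
    apply Rle_trans with (2 * b * (t * t) + 2 * a * (t * t)).
    + pose proof (COS_bound (2 * x * t)). apply Rabs_le; nra.
    + nra.
  - rewrite Rabs_mult, (Rabs_pos_eq (cos t ^ n)), Rabs_Ropp, Rabs_mult by auto.
    apply Rmult_le_compat_r; auto.
    apply Rle_trans with (4 * d * (t * t)).
    + assert (Hsx : Rabs (sin (2 * x * t)) <= 2 * Rabs x * t).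
      { eapply Rle_trans; [apply Rabs_sin_le|].
        rewrite !Rabs_mult, (Rabs_pos_eq 2), (Rabs_pos_eq t) by lra; lra. }
      replace (4 * d * (t * t)) with ((2 * Rabs x * t) * (2 * Rabs y * t * M)) by (unfold d; ring).
      apply Rmult_le_compat; auto using Rabs_pos.
    + nra.
Qed.

(** The mass of cos(t)^n concentrates at t = 0, where cos(2zt) = 1. Only even exponents occur,
    because the recursion moves by two and starts from exponent 0. *)
Lemma wallis_ratio_cv (z : Cx) :
  Cseq_cv (fun k => wallis_int z (2 * k) * RtoC (/ wallis (2 * k)))%Cx Cx1.
Proof.
  destruct z as [x y]. destruct (wallis_integrand_bound x y) as [C [HC H]].
  apply Cseq_cv_S.
  apply (Cseq_cv_squeeze _ _ (fun k => (2 * C) * / INR (S k)) 0).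
  - intros k _. set (n := (2 * S k)%nat).
    pose proof (wallis_even_pos (S k)) as Pn. fold n in Pn.
    pose proof (wallis_rec n) as Rn.
    assert (B1 : Rabs (RInt (wallis_re x y n) 0 (PI / 2) - wallis n)
                 <= C * (wallis n - wallis (S (S n)))).
    { replace (RInt (wallis_re x y n) 0 (PI / 2) - wallis n) with
        (RInt (fun t => minus (wallis_re x y n t) (cos t ^ n)) 0 (PI / 2)).
      - apply Rabs_RInt_cos_pow_le; [|intros t Ht; apply (H n t Ht)].
        intros t; apply (continuous_minus (V := R_NormedModule));
          auto using continuous_wallis_re, continuous_cos_pow.
      - apply (RInt_minus (V := R_CompleteNormedModule));
          apply (@ex_RInt_continuous R_CompleteNormedModule);
          auto using continuous_wallis_re, continuous_cos_pow. }
    assert (B2 : Rabs (RInt (wallis_im x y n) 0 (PI / 2)) <= C * (wallis n - wallis (S (S n)))).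
    { apply Rabs_RInt_cos_pow_le; [apply continuous_wallis_im | intros t Ht; apply (H n t Ht)]. }
    assert (E : wallis n - wallis (S (S n)) <= wallis n * / INR (S k)).
    { assert (Nk : INR (S k) > 0) by (apply lt_0_INR; lia).
      assert (Nn : INR n = 2 * INR (S k)) by (unfold n; rewrite mult_INR; reflexivity).
      apply Rmult_le_reg_l with (INR (S (S n)) * INR (S k)).
      - apply Rmult_lt_0_compat; auto. apply lt_0_INR; lia.
      - replace (INR (S (S n)) * INR (S k) * (wallis n - wallis (S (S n)))) with
          (INR (S k) * (INR (S (S n)) * wallis n - INR (S (S n)) * wallis (S (S n)))) by ring.
        rewrite Rn. replace (INR (S (S n)) * INR (S k) * (wallis n * / INR (S k))) with
          (INR (S (S n)) * wallis n) by (field; lra).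
        rewrite (S_INR (S n)), (S_INR n), Nn. set (K := INR (S k)) in *.
        assert (0 < K * wallis n) by (apply Rmult_lt_0_compat; auto). nra. }
    match goal with |- Cnorm ?t <= _ => replace t with
      ((wallis_int (mkC x y) n - RtoC (wallis n)) * RtoC (/ wallis n))%Cx end.
    2: { rewrite RtoC_inv. pose proof (RtoC_neq0 (wallis n)). field. apply H0; lra. }
    rewrite Cnorm_mul, Cnorm_RtoC, Rabs_pos_eq by (apply Rlt_le, Rinv_0_lt_compat, Pn).
    apply Rle_trans with ((2 * C * (wallis n * / INR (S k))) * / wallis n).
    2: { right; field. split; [apply not_0_INR; lia | lra]. }
    apply Rmult_le_compat_r; [apply Rlt_le, Rinv_0_lt_compat, Pn|].
    eapply Rle_trans; [apply Cnorm_le_Rabs|]. simpl Re; simpl Im.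
    rewrite Ropp_0, Rplus_0_r.
    unfold Rminus in B1. pose proof (Rmult_le_compat_l C _ _ HC E). lra.
  - rewrite <- (Rmult_0_r (2 * C)). apply CV_mult.
    + intros e He; exists O; intros; rewrite Rdist_eq; lra.
    + pose proof cv_inv_INR_S as K; apply Cseq_cv_components in K; exact (proj1 K).
Qed.

(** * Euler's sine product and reflection *)

Fixpoint sine_prod (z : Cx) (n : nat) : Cx :=
  match n with
  | O => z
  | S k => (sine_prod z k * (Cx1 - z * z / (RtoC (INR (S k)) * RtoC (INR (S k)))))%Cx
  end.

Lemma sine_prod_S (z : Cx) (k : nat) : sine_prod z (S k) =
  (sine_prod z k * (Cx1 - z * z / (RtoC (INR (S k)) * RtoC (INR (S k)))))%Cx.
Proof. reflexivity. Qed.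
(** An invariant in k: the new factor 1 - z^2/(k+1)^2 is compensated by the recursion for the
    integral, normalised by its value at z = 0. The case k = 0 gives the constant. *)
Lemma sine_prod_wallis (z : Cx) (k : nat) :
  (sine_prod z k * (wallis_int z (2 * k) * RtoC (/ wallis (2 * k))))%Cx
  = (Csin (z * CPI)%Cx / CPI)%Cx.
Proof.
  pose proof PI_RGT_0 as HPI.
  assert (HC : CPI <> Cx0) by (apply RtoC_neq0; lra).
  induction k as [|k IH].
  - rewrite Nat.mul_0_r, wallis_0, <- wallis_int_0. simpl sine_prod.
    replace (/ (PI / 2)) with (2 * / PI) by (field; lra).
    rewrite RtoC_mul, RtoC_inv. unfold Cdiv; fold CPI; ring.
  - rewrite <- IH, sine_prod_S.
    replace (2 * S k)%nat with (S (S (2 * k))) by lia.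
    set (n := (2 * k)%nat).
    pose proof (wallis_int_rec z n) as J. pose proof (wallis_rec n) as W.
    pose proof (wallis_even_pos k) as P0. fold n in P0.
    pose proof (wallis_even_pos (S k)) as P2.
    replace (2 * S k)%nat with (S (S n)) in P2 by (unfold n; lia).
    assert (N2 : INR (S (S n)) = 2 * INR (S k)) by (unfold n; rewrite !S_INR, mult_INR; simpl INR; ring).
    rewrite N2 in *.
    assert (N0 : 0 < INR (S k)) by (apply lt_0_INR; lia).
    assert (Wv : wallis n = 2 * INR (S k) * wallis (S (S n)) / INR (S n)).
    { rewrite W; field. apply not_0_INR; lia. }
    assert (N1 : RtoC (INR (S n)) <> Cx0) by apply RtoC_S_neq0.
    pose proof (RtoC_S_neq0 k) as K0.
    assert (Wne : RtoC (wallis (S (S n))) <> Cx0) by (apply RtoC_neq0; lra).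
    assert (D2 : RtoC 2 <> Cx0) by (apply RtoC_neq0; lra).
    (* Solved for the lower integral: (k+1)^2 - z^2 may be zero, so only integers are divided by. *)
    assert (JJ : wallis_int z n = ((RtoC 2 * RtoC 2 * (RtoC (INR (S k)) * RtoC (INR (S k)) - z * z))
        * wallis_int z (S (S n)) / (RtoC 2 * RtoC (INR (S k)) * RtoC (INR (S n))))%Cx).
    { transitivity (RtoC (2 * INR (S k) * INR (S n)) * wallis_int z n /
        (RtoC 2 * RtoC (INR (S k)) * RtoC (INR (S n))))%Cx.
      - rewrite !RtoC_mul; field; auto.
      - rewrite <- J. rewrite !RtoC_mul. replace (RtoC 4) with (RtoC 2 * RtoC 2)%Cx by cx.
        field; auto. }
    rewrite JJ, Wv. unfold Rdiv; rewrite !RtoC_inv, !RtoC_mul, RtoC_inv.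
    field; auto 10.
Qed.

(** Pair z + j with j - z for 1 <= j <= n, each pair giving j^2 (1 - z^2/j^2); the unpaired factor z
    explains the lengths [S n] and [n]. *)
Lemma poch_mul_reflect (z : Cx) (n : nat) :
  (poch z (S n) * poch (Cx1 - z)%Cx n)%Cx =
  (sine_prod z n * (RtoC (INR (fact n)) * RtoC (INR (fact n))))%Cx.
Proof.
  induction n as [|n IH].
  - simpl; change (RtoC 1) with Cx1; change (RtoC 0) with Cx0; ring.
  - replace (fact (S n)) with (S n * fact n)%nat by reflexivity.
    rewrite mult_INR, RtoC_mul.
    change (poch z (S (S n))) with (poch z (S n) * (z + RtoC (INR (S n))))%Cx.
    change (poch (Cx1 - z)%Cx (S n)) with (poch (Cx1 - z)%Cx n * (Cx1 - z + RtoC (INR n)))%Cx.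
    transitivity (poch z (S n) * poch (Cx1 - z)%Cx n *
      ((z + RtoC (INR (S n))) * (Cx1 - z + RtoC (INR n))))%Cx; [ring|].
    rewrite IH. pose proof (RtoC_S_neq0 n) as H. rewrite sine_prod_S.
    rewrite RtoC_S in *. field; auto.
Qed.

(** Multiplying by the Wallis ratio, which tends to 1, turns the product of the N-th terms into
    exactly sin(pi z)/pi times 1 + (1-z)/N. *)
Lemma rGamma_reflection (z : Cx) :
  (rGamma z * rGamma (Cx1 - z)%Cx)%Cx = (Csin (z * CPI)%Cx / CPI)%Cx.
Proof.
  apply (Cseq_cv_unique (fun n => rGamma_seq z (S n) * rGamma_seq (Cx1 - z)%Cx (S n) *
    (wallis_int z (2 * S n) * RtoC (/ wallis (2 * S n))))%Cx).
  - replace (rGamma z * rGamma (Cx1 - z)%Cx)%Cx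
      with (rGamma z * rGamma (Cx1 - z)%Cx * Cx1)%Cx by ring.
    apply Cseq_cv_mul; [apply Cseq_cv_mul|].
    + apply (Cseq_cv_S (rGamma_seq z)), rGamma_cv.
    + apply (Cseq_cv_S (rGamma_seq (Cx1 - z)%Cx)), rGamma_cv.
    + apply (Cseq_cv_S (fun k => wallis_int z (2 * k) * RtoC (/ wallis (2 * k)))%Cx), wallis_ratio_cv.
  - apply (Cseq_cv_ext (fun n => (Csin (z * CPI)%Cx / CPI) *
      (Cx1 + (Cx1 - z) * RtoC (/ INR (S n))))%Cx).
    + intros n. rewrite <- (sine_prod_wallis z (S n)).
      generalize (wallis_int z (2 * S n) * RtoC (/ wallis (2 * S n)))%Cx; intros r.
      unfold rGamma_seq.
      change (poch (Cx1 - z)%Cx (S (S n))) with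
        (poch (Cx1 - z)%Cx (S n) * (Cx1 - z + RtoC (INR (S n))))%Cx.
      pose proof (poch_mul_reflect z (S n)) as E.
      assert (W : (Cnatpow (S n) z * Cnatpow (S n) (Cx1 - z)%Cx)%Cx = RtoC (INR (S n))).
      { rewrite <- Cnatpow_add, <- Cnatpow_1 by lia; f_equal; ring. }
      pose proof (RtoC_fact_neq0 (S n)) as F0. pose proof (RtoC_S_neq0 n) as N0.
      rewrite RtoC_inv.
      set (f := RtoC (INR (fact (S n)))) in *. set (a := Cnatpow (S n) z) in *.
      set (b := Cnatpow (S n) (Cx1 - z)%Cx) in *.
      assert (a <> Cx0) by apply Cnatpow_neq0. assert (b <> Cx0) by apply Cnatpow_neq0.
      set (N := RtoC (INR (S n))) in *.
      transitivity (sine_prod z (S n) * (f * f) * (Cx1 - z + N) / (f * f * N) * r)%Cx.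
      * field; auto.
      * rewrite <- E, <- W. field; auto.
    + assert (E : (Csin (z * CPI)%Cx / CPI * (Cx1 + (Cx1 - z) * Cx0))%Cx = (Csin (z * CPI)%Cx / CPI)%Cx)
        by ring.
      refine (eq_ind _ (Cseq_cv _) _ _ E).
      apply Cseq_cv_scal, Cseq_cv_add; [apply Cseq_cv_const|].
      apply Cseq_cv_scal, cv_inv_INR_S.
Qed.

(** * Gauss' sum at complementary arguments *)

Lemma Ci_neq0 : Ci <> Cx0.
Proof. intros H; apply (f_equal Im) in H; simpl in H; lra. Qed.
Lemma Csin_add (z w : Cx) : Csin (z + w)%Cx = (Csin z * Ccos w + Ccos z * Csin w)%Cx.
Proof.
  unfold Csin, Ccos.
  replace (Ci * (z + w))%Cx with (Ci * z + Ci * w)%Cx by ring.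
  replace (- (Ci * z + Ci * w))%Cx with (- (Ci * z) + - (Ci * w))%Cx by ring.
  rewrite !Cexp_add. assert (RtoC 2 <> Cx0) by (apply RtoC_neq0; lra).
  pose proof Ci_neq0.
  replace (RtoC 2) with (Cx1 + Cx1)%Cx in * by cx. field; auto.
Qed.
Lemma Csin_opp (z : Cx) : Csin (- z)%Cx = (- Csin z)%Cx.
Proof.
  unfold Csin. replace (Ci * - z)%Cx with (- (Ci * z))%Cx by ring.
  replace (- - (Ci * z))%Cx with (Ci * z)%Cx by ring.
  unfold Cdiv; ring.
Qed.
Lemma Ccos_opp (z : Cx) : Ccos (- z)%Cx = Ccos z.
Proof.
  unfold Ccos. replace (Ci * - z)%Cx with (- (Ci * z))%Cx by ring.
  replace (- - (Ci * z))%Cx with (Ci * z)%Cx by ring.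
  unfold Cdiv; ring.
Qed.
Lemma Csin_add_sub (z w : Cx) :
  (Csin (z + w) + Csin (z - w))%Cx = (RtoC 2 * Csin z * Ccos w)%Cx.
Proof.
  replace (z - w)%Cx with (z + - w)%Cx by ring.
  rewrite !Csin_add, Csin_opp, Ccos_opp, RtoC_2; ring.
Qed.
Lemma Ccos_RtoC (x : R) : Ccos (RtoC x) = RtoC (cos x).
Proof.
  apply Cx_ext; simpl.
  - replace (0 * x - 1 * 0) with 0 by ring. rewrite Ropp_0, exp_0.
    replace (0 * 0 + 1 * x) with x by ring. rewrite cos_neg. field.
  - replace (0 * x - 1 * 0) with 0 by ring. rewrite Ropp_0, exp_0.
    replace (0 * 0 + 1 * x) with x by ring. rewrite sin_neg. field.
Qed.

(** If 2h = -m, even m would put h in Z_0^- and odd m would make cos(h pi) vanish. *)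
Lemma not_in_Zle0_double (h : Cx) :
  ~ in_Zle0 h -> Ccos (h * CPI)%Cx <> Cx0 -> ~ in_Zle0 (RtoC 2 * h)%Cx.
Proof.
  intros Hh Hcos [m E].
  assert (D2 : RtoC 2 <> Cx0) by (apply RtoC_neq0; lra).
  assert (Eh : h = RtoC (- INR m / 2)).
  { transitivity (RtoC 2 * h / RtoC 2)%Cx; [field; auto|].
    rewrite E; unfold Rdiv; rewrite RtoC_mul, RtoC_inv; reflexivity. }
  destruct (Nat.Even_or_Odd m) as [[k ->] | [k ->]].
  - apply Hh; exists k; rewrite Eh; f_equal. rewrite mult_INR; simpl INR; field.
  - apply Hcos. rewrite Eh; unfold CPI. rewrite <- RtoC_mul, Ccos_RtoC.
    rewrite cos_eq_0_1; [reflexivity|].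
    exists (- Z.of_nat k - 1)%Z.
    rewrite minus_IZR, opp_IZR, <- INR_IZR_INZ, plus_INR, mult_INR; simpl INR; field.
Qed.

(** With s + t = v, Gauss' value contains 1/Gamma(1-t) and Gamma(1-v); reflection turns them into
    sin(t pi) Gamma(t) / pi and the reciprocal of sin(v pi) Gamma(v) / pi. *)
Lemma gauss_sum_reflect (v s t : Cx) :
  Re v < 1 -> ~ in_Zle0 v -> ~ in_Zle0 s -> ~ in_Zle0 t -> (s + t)%Cx = v ->
  Csin (v * CPI)%Cx <> Cx0 /\
  gauss_sum v s = (Csin (t * CPI)%Cx * Gamma s * Gamma t / (Gamma v * Csin (v * CPI)%Cx))%Cx.
Proof.
  intros Hv Hzv Hzs Hzt E.
  assert (HC : CPI <> Cx0) by (apply RtoC_neq0; pose proof PI_RGT_0; lra).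
  assert (Hw : ~ in_Zle0 (Cx1 - v)%Cx) by (apply not_in_Zle0_Re_pos; simpl; lra).
  pose proof (rGamma_neq0 _ Hzv). pose proof (rGamma_neq0 _ Hw).
  pose proof (rGamma_neq0 _ Hzs). pose proof (rGamma_neq0 _ Hzt).
  pose proof (rGamma_reflection v) as Rv. pose proof (rGamma_reflection t) as Rt.
  assert (Sv : Csin (v * CPI)%Cx = (rGamma v * rGamma (Cx1 - v)%Cx * CPI)%Cx)
    by (rewrite Rv; field; auto).
  assert (St : Csin (t * CPI)%Cx = (rGamma t * rGamma (Cx1 - t)%Cx * CPI)%Cx)
    by (rewrite Rt; field; auto).
  split; [rewrite Sv; auto using Cmul_neq0|].
  rewrite gauss_sum_eq, !Gamma_eq_inv, Sv, St by auto.
  replace (Cx1 + s - v)%Cx with (Cx1 - t)%Cx by (rewrite <- E; ring).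
  field; auto 10 using Cmul_neq0.
Qed.

(** The two sines add up to 2 sin(h pi) cos(d pi), and sin(2h pi) = 2 sin(h pi) cos(h pi), so sin(h
    pi) cancels. *)
Lemma gauss_sum_pair (h d : Cx) :
  Re (RtoC 2 * h)%Cx < 1 -> ~ in_Zle0 h -> ~ in_Zle0 (h - d)%Cx -> ~ in_Zle0 (h + d)%Cx ->
  Ccos (h * CPI)%Cx <> Cx0 ->
  (gauss_sum (RtoC 2 * h)%Cx (h - d)%Cx + gauss_sum (RtoC 2 * h)%Cx (h + d)%Cx)%Cx =
  (Gamma (h + d)%Cx * Gamma (h - d)%Cx * Ccos (d * CPI)%Cx / Ccos (h * CPI)%Cx
     * Cinv (Gamma (RtoC 2 * h)%Cx))%Cx.
Proof.
  intros Hv Hh Hm Hp Hcos.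
  pose proof (not_in_Zle0_double h Hh Hcos) as Hzv.
  destruct (gauss_sum_reflect (RtoC 2 * h)%Cx (h - d)%Cx (h + d)%Cx) as [S0 E1]; auto;
    [rewrite RtoC_2; ring|].
  destruct (gauss_sum_reflect (RtoC 2 * h)%Cx (h + d)%Cx (h - d)%Cx) as [_ E2]; auto;
    [rewrite RtoC_2; ring|].
  rewrite E1, E2.
  assert (Sv : Csin (RtoC 2 * h * CPI)%Cx = (RtoC 2 * Csin (h * CPI) * Ccos (h * CPI))%Cx).
  { replace (RtoC 2 * h * CPI)%Cx with (h * CPI + h * CPI)%Cx by (rewrite RtoC_2; ring).
    rewrite Csin_add, RtoC_2; ring. }
  rewrite Sv in *.
  assert (G0 : Gamma (RtoC 2 * h)%Cx <> Cx0)
    by (rewrite Gamma_eq_inv by auto; auto using Cinv_neq0, rGamma_neq0).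
  assert (Sh : Csin (h * CPI)%Cx <> Cx0) by (intros E; apply S0; rewrite E; ring).
  assert (D2 : RtoC 2 <> Cx0) by (apply RtoC_neq0; lra).
  transitivity ((Csin (h * CPI + d * CPI) + Csin (h * CPI - d * CPI)) *
    Gamma (h + d)%Cx * Gamma (h - d)%Cx /
    (Gamma (RtoC 2 * h)%Cx * (RtoC 2 * Csin (h * CPI) * Ccos (h * CPI))))%Cx.
  - replace (h * CPI + d * CPI)%Cx with ((h + d) * CPI)%Cx by ring.
    replace (h * CPI - d * CPI)%Cx with ((h - d) * CPI)%Cx by ring.
    field; auto.
  - rewrite Csin_add_sub. field; auto.
Qed.

(** * Partial fractions of the hypergeometric term *)

Lemma poch_one_add (x : Cx) (n : nat) :
  (x * poch (Cx1 + x)%Cx n)%Cx = (poch x n * (x + RtoC (INR n)))%Cx.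
Proof.
  replace (Cx1 + x)%Cx with (x + Cx1)%Cx by ring. rewrite <- poch_succ_l; reflexivity.
Qed.

(** Each parameter pair x, 1 + x contributes only (x+n)/x or its inverse; the one Pochhammer symbol
    left is (v)_n. *)
Lemma pFq_term_partial_fractions (v h a b d : Cx) (n : nat) :
  (RtoC 2 * (d * d))%Cx = (a * a + b * b)%Cx ->
  ~ in_Zle0 h -> ~ in_Zle0 (h - d)%Cx -> ~ in_Zle0 (h + d)%Cx ->
  ~ in_Zle0 (h - a)%Cx -> ~ in_Zle0 (h - b)%Cx -> ~ in_Zle0 (h + a)%Cx -> ~ in_Zle0 (h + b)%Cx ->
  pFq_term
    [v; (Cx1 + h)%Cx; (Cx1 + (h - d))%Cx; (Cx1 + (h + d))%Cx;
     (h - a)%Cx; (h - b)%Cx; (h + a)%Cx; (h + b)%Cx]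
    [h; (h - d)%Cx; (h + d)%Cx;
     (Cx1 + (h - a))%Cx; (Cx1 + (h - b))%Cx; (Cx1 + (h + a))%Cx; (Cx1 + (h + b))%Cx] Cx1 n
  = ((h - a) * (h - b) * (h + a) * (h + b) / (RtoC 4 * h * (h - d) * (h + d)) *
     (rising_coef v n / (h - a + RtoC (INR n)) + rising_coef v n / (h + a + RtoC (INR n)) +
      (rising_coef v n / (h - b + RtoC (INR n)) + rising_coef v n / (h + b + RtoC (INR n)))))%Cx.
Proof.
  intros Hd Zh Zl1 Zl2 Z3 Z4 Z5 Z6.
  unfold pFq_term, rising_coef; simpl map; simpl Cprod_list.
  assert (P1 : Cpow Cx1 n = Cx1) by (induction n as [|n IH]; simpl; rewrite ?IH; cx).
  rewrite P1; clear P1.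
  set (N := RtoC (INR n)).
  assert (U : forall x, ~ in_Zle0 x -> x <> Cx0 /\ poch x n <> Cx0 /\ (x + N)%Cx <> Cx0 /\
    poch (Cx1 + x)%Cx n = (poch x n * (x + N) / x)%Cx).
  { intros x Hx. pose proof (not_in_Zle0_neq0 x Hx).
    repeat split; auto using poch_neq0; [apply not_in_Zle0_add, Hx|].
    unfold N; rewrite <- poch_one_add; field; auto. }
  destruct (U _ Zh) as [h0 [ph [hn ->]]].
  destruct (U _ Zl1) as [l10 [pl1 [l1n ->]]]. destruct (U _ Zl2) as [l20 [pl2 [l2n ->]]].
  destruct (U _ Z3) as [s30 [p3 [s3n ->]]]. destruct (U _ Z4) as [s40 [p4 [s4n ->]]].
  destruct (U _ Z5) as [s50 [p5 [s5n ->]]]. destruct (U _ Z6) as [s60 [p6 [s6n ->]]].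
  clear U.
  pose proof (RtoC_fact_neq0 n) as F0.
  assert (D4 : RtoC 4 <> Cx0) by (apply RtoC_neq0; lra).
  assert (D2 : RtoC 2 <> Cx0) by (apply RtoC_neq0; lra).
  (* The choice of d makes the numerator factor (h+n)^2 - d^2 the mean of (h+n)^2 - a^2
     and (h+n)^2 - b^2, hence the partial fractions decouple. *)
  assert (K : ((h + N) * ((h - d + N) * (h + d + N)) /
    ((h - a + N) * (h - b + N) * (h + a + N) * (h + b + N)))%Cx =
    ((Cinv (h - a + N) + Cinv (h + a + N) + (Cinv (h - b + N) + Cinv (h + b + N))) / RtoC 4)%Cx).
  { replace ((h - d + N) * (h + d + N))%Cx with
      (((h - a + N) * (h + a + N) + (h - b + N) * (h + b + N)) / RtoC 2)%Cx.
    - replace (RtoC 4) with ((Cx1 + Cx1) * (Cx1 + Cx1))%Cx in * by cx.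
      rewrite RtoC_2 in *.
      clear - s3n s4n s5n s6n D2 D4. field; auto 10.
    - transitivity (((RtoC 2 * ((h + N) * (h + N))) - (a * a + b * b)) / RtoC 2)%Cx;
        [rewrite RtoC_2 in *; field; auto|].
      rewrite <- Hd; field; auto. }
  (* Pochhammer symbols and shifted parameters become independent variables, tied together only by
     [K], which keeps the final [field] problems small. *)
  clear Hd Zh Zl1 Zl2 Z3 Z4 Z5 Z6.
  revert h0 ph hn l10 pl1 l1n l20 pl2 l2n s30 p3 s3n s40 p4 s4n s50 p5 s5n s60 p6 s6n F0 K.
  generalize (poch h n) (poch (h - d)%Cx n) (poch (h + d)%Cx n) (poch (h - a)%Cx n)
    (poch (h - b)%Cx n) (poch (h + a)%Cx n) (poch (h + b)%Cx n) (poch v n) (RtoC (INR (fact n))).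
  generalize (h + N)%Cx (h - d + N)%Cx (h + d + N)%Cx (h - a + N)%Cx
    (h - b + N)%Cx (h + a + N)%Cx (h + b + N)%Cx.
  generalize (h - d)%Cx (h + d)%Cx (h - a)%Cx (h - b)%Cx (h + a)%Cx (h + b)%Cx.
  clear N; intros l1 l2 x3 x4 x5 x6 y y1 y2 y3 y4 y5 y6 q q1 q2 q3 q4 q5 q6 q7 f.
  intros.
  transitivity (x3 * x4 * x5 * x6 / (h * l1 * l2) * (q7 / f) *
    (y * (y1 * y2) / (y3 * y4 * y5 * y6)))%Cx.
  - field; auto 30.
  - rewrite K. unfold Cdiv. field; auto 20.
Qed.

Lemma pFq_sums_partial_fractions (h a b d : Cx) :
  (RtoC 2 * (d * d))%Cx = (a * a + b * b)%Cx -> Re (RtoC 2 * h)%Cx < 1 ->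
  ~ in_Zle0 h -> ~ in_Zle0 (h - d)%Cx -> ~ in_Zle0 (h + d)%Cx ->
  ~ in_Zle0 (h - a)%Cx -> ~ in_Zle0 (h - b)%Cx -> ~ in_Zle0 (h + a)%Cx -> ~ in_Zle0 (h + b)%Cx ->
  Ccos (h * CPI)%Cx <> Cx0 ->
  pFq_sums
    [(RtoC 2 * h)%Cx; (Cx1 + h)%Cx; (Cx1 + (h - d))%Cx; (Cx1 + (h + d))%Cx;
     (h - a)%Cx; (h - b)%Cx; (h + a)%Cx; (h + b)%Cx]
    [h; (h - d)%Cx; (h + d)%Cx;
     (Cx1 + (h - a))%Cx; (Cx1 + (h - b))%Cx; (Cx1 + (h + a))%Cx; (Cx1 + (h + b))%Cx] Cx1
    ((h - a) * (h - b) * (h + a) * (h + b) / (RtoC 4 * h * (h - d) * (h + d)) *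
     (Gamma (h + a)%Cx * Gamma (h - a)%Cx * Ccos (a * CPI)%Cx / Ccos (h * CPI)%Cx
        * Cinv (Gamma (RtoC 2 * h)%Cx) +
      Gamma (h + b)%Cx * Gamma (h - b)%Cx * Ccos (b * CPI)%Cx / Ccos (h * CPI)%Cx
        * Cinv (Gamma (RtoC 2 * h)%Cx)))%Cx.
Proof.
  intros Hd Hv Zh Zl1 Zl2 Z3 Z4 Z5 Z6 Hcos.
  rewrite <- !gauss_sum_pair by auto.
  set (v := (RtoC 2 * h)%Cx) in *.
  match goal with |- pFq_sums _ _ _ (?k * _)%Cx => set (K := k) end.
  apply (Cseq_cv_ext (fun n => K * (gauss_psum v (h - a)%Cx n + gauss_psum v (h + a)%Cx n +
    (gauss_psum v (h - b)%Cx n + gauss_psum v (h + b)%Cx n)))%Cx).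
  - intros n; unfold gauss_psum; rewrite <- !Csum_add, <- Csum_scal.
    apply Csum_ext; intros k; symmetry; apply pFq_term_partial_fractions; auto.
  - apply Cseq_cv_scal; repeat apply Cseq_cv_add; apply gauss_psum_cv, Hv.
Qed.

Theorem mainTheorem8 (v a b c s : Cx)
  (Hv : Re v < 1) (Hc : Re c > 0)
  (H1 : Re (v * c + a + b)%Cx > 0) (H2 : Re (v * c + a - b)%Cx > 0)
  (H3 : Re (v * c - a + b)%Cx > 0) (H4 : Re (v * c - a - b)%Cx > 0)
  (Hs : (s * s)%Cx = (a * a + b * b)%Cx) :
  let l1 := (v / RtoC 2 - s / (RtoC 2 * c))%Cx in
  let l2 := (v / RtoC 2 + s / (RtoC 2 * c))%Cx in
  let s3 := (v / RtoC 2 - a / (RtoC 2 * c) - b / (RtoC 2 * c))%Cx in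
  let s4 := (v / RtoC 2 - a / (RtoC 2 * c) + b / (RtoC 2 * c))%Cx in
  let s5 := (v / RtoC 2 + a / (RtoC 2 * c) + b / (RtoC 2 * c))%Cx in
  let s6 := (v / RtoC 2 + a / (RtoC 2 * c) - b / (RtoC 2 * c))%Cx in
  let P := ((v * c - a - b) * (v * c + a + b) * (v * c - a + b) * (v * c + a - b))%Cx in
  ~ in_Zle0 (v / RtoC 2)%Cx -> ~ in_Zle0 l1 -> ~ in_Zle0 l2 ->
  ~ in_Zle0 (Cx1 + s3)%Cx -> ~ in_Zle0 (Cx1 + s4)%Cx ->
  ~ in_Zle0 (Cx1 + s5)%Cx -> ~ in_Zle0 (Cx1 + s6)%Cx ->
  (* the right-hand side is literally defined only when cos(v pi/2) <> 0 *)
  Ccos (v * CPI / RtoC 2)%Cx <> Cx0 ->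
  pFq_sums
    [v; (Cx1 + v / RtoC 2)%Cx; (Cx1 + l1)%Cx; (Cx1 + l2)%Cx; s3; s4; s5; s6]
    [(v / RtoC 2)%Cx; l1; l2; (Cx1 + s3)%Cx; (Cx1 + s4)%Cx; (Cx1 + s5)%Cx; (Cx1 + s6)%Cx]
    Cx1
    (P / (RtoC 8 * (v * v * v * (c * c * c * c) - a * a * v * (c * c)
                     - b * b * v * (c * c)) * Gamma v)
     * (Gamma s5 * Gamma s3 * Ccos ((a + b) * CPI / (RtoC 2 * c))
          / Ccos (v * CPI / RtoC 2)
        + Gamma s6 * Gamma s4 * Ccos ((a - b) * CPI / (RtoC 2 * c))
          / Ccos (v * CPI / RtoC 2)))%Cx.

Proof.
  intros l1 l2 s3 s4 s5 s6 P Zh Zl1 Zl2 Z3 Z4 Z5 Z6 Hcos.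
  assert (D2 : RtoC 2 <> Cx0) by (apply RtoC_neq0; lra).
  assert (Hc0 : c <> Cx0) by (intros ->; simpl in Hc; lra).
  set (h := (v / RtoC 2)%Cx) in *.
  set (p := ((a + b) / (RtoC 2 * c))%Cx). set (q := ((a - b) / (RtoC 2 * c))%Cx).
  set (d := (s / (RtoC 2 * c))%Cx) in *.
  assert (Ev : v = (RtoC 2 * h)%Cx) by (unfold h; field; auto).
  assert (Ea : a = (c * (p + q))%Cx) by (unfold p, q; rewrite RtoC_2 in *; field; auto).
  assert (Eb : b = (c * (p - q))%Cx) by (unfold p, q; rewrite RtoC_2 in *; field; auto).
  assert (Es : s = (RtoC 2 * c * d)%Cx) by (unfold d; field; auto).
  assert (E3 : s3 = (h - p)%Cx) by (unfold s3, p; field; auto).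
  assert (E4 : s4 = (h - q)%Cx) by (unfold s4, q; field; auto).
  assert (E5 : s5 = (h + p)%Cx) by (unfold s5, p; field; auto).
  assert (E6 : s6 = (h + q)%Cx) by (unfold s6, q; field; auto).
  assert (Ep : ((a + b) * CPI / (RtoC 2 * c))%Cx = (p * CPI)%Cx) by (unfold p; field; auto).
  assert (Eq : ((a - b) * CPI / (RtoC 2 * c))%Cx = (q * CPI)%Cx) by (unfold q; field; auto).
  assert (Eh : (v * CPI / RtoC 2)%Cx = (h * CPI)%Cx) by (unfold h; field; auto).
  assert (Hd : (RtoC 2 * (d * d))%Cx = (p * p + q * q)%Cx).
  { transitivity ((Cx1 + Cx1) * (s * s) / (RtoC 2 * RtoC 2 * c * c))%Cx.
    - rewrite <- RtoC_2; unfold d; field; auto.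
    - rewrite Hs; unfold p, q; field; auto. }
  rewrite Ep, Eq, Eh in *. clear Ep Eq Eh.
  unfold l1, l2 in *; clear l1 l2. rewrite E3, E4, E5, E6 in *. clear s3 s4 s5 s6 E3 E4 E5 E6.
  (* From here on h, p, q, d are the free variables, and v, a, b, s are polynomials in them and
     c. *)
  clearbody h p q d. subst v a b s.
  (* Each real-part hypothesis concerns 2c sigma_j, so sigma_j <> 0; together with 1 + sigma_j
     outside Z_0^- this puts sigma_j itself outside Z_0^-. *)
  assert (NZ : forall x w, Re w > 0 -> w = (RtoC 2 * c * x)%Cx -> x <> Cx0).
  { intros x w Hw E Hx; rewrite E, Hx in Hw.
    replace (RtoC 2 * c * Cx0)%Cx with Cx0 in Hw by ring; simpl in Hw; lra. }
  assert (Y3 : ~ in_Zle0 (h - p)%Cx)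
    by (apply not_in_Zle0_pred; [exact Z3 | apply (NZ _ _ H4); rewrite RtoC_2; ring]).
  assert (Y4 : ~ in_Zle0 (h - q)%Cx)
    by (apply not_in_Zle0_pred; [exact Z4 | apply (NZ _ _ H3); rewrite RtoC_2; ring]).
  assert (Y5 : ~ in_Zle0 (h + p)%Cx)
    by (apply not_in_Zle0_pred; [exact Z5 | apply (NZ _ _ H1); rewrite RtoC_2; ring]).
  assert (Y6 : ~ in_Zle0 (h + q)%Cx)
    by (apply not_in_Zle0_pred; [exact Z6 | apply (NZ _ _ H2); rewrite RtoC_2; ring]).
  pose proof (pFq_sums_partial_fractions h p q d Hd Hv Zh Zl1 Zl2 Y3 Y4 Y5 Y6 Hcos) as L.
  match type of L with pFq_sums _ _ _ ?l => match goal with |- pFq_sums _ _ _ ?r =>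
    replace r with l; [exact L|] end end.
  assert (EP : P = (RtoC 16 * (c * c * c * c) * ((h - p) * (h - q) * (h + p) * (h + q)))%Cx).
  { unfold P. replace (RtoC 16) with (RtoC 2 * RtoC 2 * RtoC 2 * RtoC 2)%Cx by cx.
    rewrite RtoC_2; ring. }
  (* v c^2 (v^2 c^2 - a^2 - b^2) = 8 c^4 h (h^2 - d^2), by 2 d^2 = p^2 + q^2. With the 16 c^4 in P,
     the prefactor becomes 16/64 = 1/4, as in the partial fractions. *)
  match goal with |- _ = (P / (RtoC 8 * ?D * _) * _)%Cx =>
    assert (ED : D = (RtoC 8 * (c * c * c * c) * (h * (h - d) * (h + d)))%Cx) end.
  { transitivity (RtoC 2 * RtoC 2 * h * (c * c * c * c) *
      (RtoC 2 * (h * h) - (p * p + q * q)))%Cx.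
    - rewrite RtoC_2; ring.
    - rewrite <- Hd. replace (RtoC 8) with (RtoC 2 * RtoC 2 * RtoC 2)%Cx by cx. ring. }
  rewrite EP, ED.
  pose proof (not_in_Zle0_double h Zh Hcos) as Yv.
  assert (G0 : Gamma (RtoC 2 * h)%Cx <> Cx0)
    by (rewrite Gamma_eq_inv by auto; auto using Cinv_neq0, rGamma_neq0).
  replace (RtoC 16) with (RtoC 2 * RtoC 2 * RtoC 2 * RtoC 2)%Cx by cx.
  replace (RtoC 8) with (RtoC 2 * RtoC 2 * RtoC 2)%Cx by cx.
  replace (RtoC 4) with (RtoC 2 * RtoC 2)%Cx by cx.
  apply not_in_Zle0_neq0 in Zh, Zl1, Zl2. clear - D2 Hc0 Zh Zl1 Zl2 G0 Hcos.
  revert Zl1 Zl2 G0 Hcos.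
  generalize (Gamma (RtoC 2 * h)%Cx) (Gamma (h + p)%Cx) (Gamma (h - p)%Cx) (Gamma (h + q)%Cx)
    (Gamma (h - q)%Cx) (Ccos (p * CPI)%Cx) (Ccos (q * CPI)%Cx) (Ccos (h * CPI)%Cx)
    (h - d)%Cx (h + d)%Cx (h - p)%Cx (h - q)%Cx (h + p)%Cx (h + q)%Cx.
  intros. field; auto 10.
Qed.
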